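(* Let $p$ be a large prime number, $T$ a divisor of $p-1$, and $\lambda\in\mathbb{Z}_p$ an element of multiplicative order $T$. Let $\gamma(n)$ be any complex coefficients with $|\gamma(n)|\le 1$, and let $a$ be any integer coprime to $p$. Then for any integers $K$ and $N$ with $$0<K+1\le K+N\le p-1,\qquad N\ge Tp^{-1/2}(\log p)^3,$$ and any set $\mathcal{X}\subset\mathbb{Z}_{p-1}$, the inequality $$\sum_{x\in\mathcal{X}}\Big|\sum_{y=K+1}^{K+N}\gamma(y)\,\mathbf{e}_p(a\lambda^{xy})\Big|\ll\frac{|\mathcal{X}|^{1/2}N^{3/4}p^{\frac78+o(1)}}{T^{1/4}}$$ holds.
   Context: For a positive integer $m$, $\mathbb{Z}_m=\{0,1,\dots,m-1\}$ denotes the residue ring modulo $m$, and $\mathbf{e}_m(z)=\exp(2\pi i z/m)$. $|\mathcal{X}|$ is the cardinality of $\mathcal{X}$. The symbol $\ll$ is Vinogradov's symbol, and $o(1)$ refers to $p\to\infty$, uniformly in all other parameters: that is, for every $\eta>0$ there is a constant $C(\eta)$ depending only on $\eta$ such that the left side is at most $C(\eta)|\mathcal{X}|^{1/2}N^{3/4}p^{7/8+\eta}T^{-1/4}$ for all admissible $p,T,\lambda,\gamma,a,K,N,\mathcal{X}$. *)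

(* Defs.v *)
From HB Require Import structures.
From mathcomp Require Export all_boot all_order all_algebra.
From mathcomp Require Export complex.
From mathcomp Require Export reals sequences exp trigo.

Set Implicit Arguments.
Unset Strict Implicit.
Unset Printing Implicit Defensive.

Import Order.TTheory GRing.Theory Num.Theory.

Local Open Scope ring_scope.
Local Open Scope complex_scope.

(* exp(u + iv) = e^u (cos v + i sin v); MathComp-Analysis has no complex
   exponential. *)
Definition cexp (R : realType) (z : R[i]) : R[i] :=
  (expR (complex.Re z))%:C * (cos (complex.Im z) +i* sin (complex.Im z)).

Definition e_ (R : realType) (m : nat) (z : int) : R[i] :=
  cexp ((2 * pi)%:C * 'i%C * z%:~R / m%:R).

(* Main.v *)
Require Import Defs.
From mathcomp Require Import all_field cyclic.
From mathcomp Require Import ring zify lra.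
Import Order.TTheory GRing.Theory Num.Theory.

Set Implicit Arguments.
Unset Strict Implicit.
Unset Printing Implicit Defensive.

(* By Cauchy-Schwarz it suffices to bound the mean square over [x < p - 1] of the
   inner sum. Splitting according to [gcd x T], one is led, for each divisor [M]
   of [T] and [mu] of order [M], to the mean square over the units [x] modulo [M]
   of [\sum_y gamma y * psi (a * mu ^+ (x * y))]. For [u] coprime to [M], the
   dilation [x -> u * x] permutes the units; averaging over all such [u <= B] and
   using duality for each fixed [x] replaces the arbitrary coefficients [gamma]
   by sums over [y] in the interval of [psi (a * (mu ^+ (u * x * y) - mu ^+ (v *
   x * y)))]. On average over the units [x] these are square-root small, apart
   from the contribution of the mean of the summand; its sum over a full period
   is at most [B * sqrt p] by Weil's bound for the binomials
   [a * (X^(m * u) - X^(m * v))], [m = (p - 1) / M].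

   Weil's bound is derived from its elementary ingredients: Stepanov's method on
   the curve [y^p - y = f(x)] over the extensions of even degree of F_p, the
   polynomiality of the L-function of the character sum, and the fact that a
   bounded sequence of power sums has all its terms in the unit disc. *)

(** * Divisors and integers coprime to a modulus *)

(** The factor p^o(1) comes only from [tau], a common bound for the number of divisors of the
    divisors of T. It enters the mean square twice: once for the number of moduli M, once because at
    least B / (4 tau) of the integers up to B are coprime to M. With n admissible dilations the
    diagonal costs N^2 M / n, while Weil's bound costs N^2 B p^(1/2). Balancing them gives B =
    M^(1/2) p^(-1/4) and the total N^2 M^(1/2) p^(1/4), which is at most N^(3/2) p^(3/4) T^(1/2)
    because N <= p and M <= T. Stepanov's method bounds point counts only from above. This is
    enough, since the p fibres of the trace have a known total size, so that no fibre can be small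
    unless others are large. The resulting constant 2 p d is poor, but it is the same over all large
    extensions of even degree, and any uniform constant confines the inverse roots of the L-function
    to the disc of radius p^(1/2). *)

Lemma size_divisors n : size (divisors n) = \prod_(f <- prime_decomp n) f.2.+1.
Proof.
rewrite /divisors; elim: (prime_decomp n) => [|[q e] s IH]; first by rewrite big_nil.
rewrite big_cons /= -IH; set D := foldr _ _ _.
elim: e => [|e IHe] /=; first by rewrite mul1n.
by rewrite size_merge size_cat size_map IHe; lia.
Qed.

(** This is the k-th power of e + 1 <= k 2^floor(e / k). *)
Lemma expSn_le_pow2 e k : (0 < k) -> e.+1 ^ k <= k ^ k * 2 ^ e.
Proof.
move=> k0; have H : e.+1 <= k * 2 ^ (e %/ k).
  apply: leq_trans (_ : k * (e %/ k).+1 <= _).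
    by rewrite {1}(divn_eq e k) mulnSr mulnC -addnS leq_add2l ltn_mod.
  by rewrite leq_mul2l ltn_expl ?orbT.
apply: leq_trans (_ : (k * 2 ^ (e %/ k)) ^ k <= _); first by rewrite leq_exp2r.
by rewrite expnMn leq_mul2l -expnM leq_exp2l // leq_trunc_div orbT.
Qed.

(** A prime q >= 2^k satisfies (e + 1)^k <= 2^(k e) <= q^e and loses nothing. There are fewer than
    2^k smaller primes, and each costs at most the factor k^k. *)
Lemma divisors_bound k : (0 < k) ->
  exists2 c, 0 < c & forall n, 0 < n -> size (divisors n) ^ k <= c * n.
Proof.
move=> k0; exists ((k ^ k) ^ (2 ^ k)) => [|n n0]; first by rewrite !expn_gt0 k0.
rewrite size_divisors; have kk0 : 0 < k ^ k by rewrite expn_gt0 k0.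
have prim f : f \in prime_decomp n -> 1 < f.1.
  by case: f => q e /mem_prime_decomp[/prime_gt1].
apply: leq_trans (_ : \prod_(f <- prime_decomp n) ((if f.1 < 2 ^ k then k ^ k else 1) * f.1 ^ f.2) <= _).
  rewrite (big_morph (fun x => x ^ k) (fun a b => expnMn a b k) (exp1n k)).
  rewrite big_seq [X in _ <= X]big_seq; apply: leq_prod => f /prim f1.
  case: ltnP => [ltf|lef].
    apply: leq_trans (expSn_le_pow2 _ k0) _; rewrite leq_mul2l; apply/orP; right.
    by case: (f.2) => // e; rewrite leq_exp2r.
  rewrite mul1n; apply: leq_trans (_ : (2 ^ k) ^ f.2 <= _).
    by rewrite -expnM mulnC expnM leq_exp2r // ltn_expl.
  by case: (f.2) => // e; rewrite leq_exp2r.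
rewrite big_split /= -(prod_prime_decomp n0) leq_mul2r; apply/orP; right.
rewrite -big_mkcond big_const_seq iter_muln_1.
apply: leq_pexp2l => //; rewrite -size_filter.
have := filter_uniq (fun q => q < 2 ^ k) (primes_uniq n).
have -> : size [seq f <- prime_decomp n | f.1 < 2 ^ k] = size [seq q <- primes n | q < 2 ^ k].
  by rewrite /primes /unzip1 filter_map size_map.
move/uniq_leq_size => /(_ (iota 0 (2 ^ k))); rewrite size_iota; apply => q.
by rewrite mem_filter mem_iota => /andP[].
Qed.

Definition squarefree n := all (fun q => ~~ (q ^ 2 %| n)) (iota 2 n).

Lemma squarefreeP n q : 0 < n -> squarefree n -> 1 < q -> ~~ (q ^ 2 %| n).
Proof.
move=> n0 /allP sf q1; apply/negP => qn.
have : q \in iota 2 n.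
  rewrite mem_iota q1 /=; have := dvdn_leq n0 qn; rewrite expnS expn1; nia.
by move/sf; rewrite qn.
Qed.

(** With d = gcd(n, M), a prime dividing both M and n / d would divide n twice. *)
Lemma squarefree_split M n : 0 < M -> 0 < n -> squarefree n ->
  exists d u, [/\ d %| M, coprime u M & n = d * u].
Proof.
move=> M0 n0 sf; exists (gcdn n M), (n %/ gcdn n M); split.
- exact: dvdn_gcdr.
- set g := gcdn n M; have gn : g %| n by apply: dvdn_gcdl.
  have u0 : 0 < n %/ g by rewrite divn_gt0 ?gcdn_gt0 ?n0 // dvdn_leq.
  rewrite coprime_has_primes //; apply/hasPn => q; rewrite !mem_primes.
  case/and3P => q_pr _ qM; apply/negP => /and3P[_ _ qu].
  have qn : q %| n by rewrite -(divnK gn) dvdn_mulr.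
  have /negP := squarefreeP n0 sf (prime_gt1 q_pr); apply.
  by rewrite -(divnK gn) expnS expn1 dvdn_mul // dvdn_gcd qn.
- by rewrite mulnC divnK // dvdn_gcdl.
Qed.

Lemma count_dvd_le D B : 0 < D -> count (dvdn D) (iota 1 B) <= B %/ D.
Proof.
move=> D0; rewrite -size_filter -[X in _ <= X](size_iota 1) -[X in _ <= X](size_map (muln D)).
apply: uniq_leq_size => [|n]; first by rewrite filter_uniq ?iota_uniq.
rewrite mem_filter mem_iota => /andP[/dvdnP[e ->] /andP[e0 eB]].
apply/mapP; exists e; rewrite ?[D * e]mulnC // mem_iota.
rewrite muln_gt0 in e0; case/andP: e0 => e0 _.
by rewrite e0 add1n ltnS leq_divRL //; lia.
Qed.

(** Telescoping 1 / (q + 1)^2 <= 1 / q - 1 / (q + 1) from the exact value 1 / 4 at q = 2. Fewer than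
    3 / 4 of the integers are thus lost, which leaves a quarter of them squarefree. *)
Lemma sum_inv_squares B Q : 2 <= Q ->
  ((\sum_(2 <= q < Q.+1) (B %/ q ^ 2))%:R * 4 <= B%:R * (3 - 4 / Q%:R) :> rat)%R.
Proof.
elim: Q => // Q IH; rewrite ltnS leq_eqVlt => /orP[/eqP <-|Q2].
  rewrite big_nat1; have : (B %/ 2 ^ 2 * 2 ^ 2 <= B)%N by apply: leq_trunc_div.
  rewrite -(ler_nat rat) natrM => H.
  rewrite (_ : 3 - 4 / 2%:R = 1 :> rat)%R; last by field.
  by rewrite mulr1; apply: le_trans H.
rewrite big_nat_recr /= ?natrD; last by lia.
have Q0 : (0 < Q%:R :> rat)%R by rewrite ltr0n; lia.
have B0 : (0 <= B%:R :> rat)%R by rewrite ler0n.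
have H : ((B %/ Q.+1 ^ 2)%:R <= B%:R / (Q%:R * Q.+1%:R) :> rat)%R.
  rewrite ler_pdivlMr; last by rewrite mulr_gt0 // ltr0n.
  rewrite -!natrM ler_nat.
  apply: leq_trans (leq_trunc_div B (Q.+1 ^ 2)).
  by rewrite leq_mul2l; apply/orP; right; rewrite expnS expn1; lia.
apply: le_trans (_ : B%:R * (3 - 4 / Q%:R) + B%:R / (Q%:R * Q.+1%:R) * 4 <= _)%R.
  by rewrite mulrDl lerD ?IH // ler_wpM2r.
rewrite -addn1 natrD le_eqVlt; apply/orP; left; apply/eqP; field.
by apply/andP; split; lra.
Qed.

Lemma squarefree_count B : B <= 4 * count squarefree (iota 1 B).
Proof.
have [B2|B2] := leqP 2 B; last by case: B B2 => [|[]].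
have nsf : count (predC squarefree) (iota 1 B) <= \sum_(2 <= q < B.+1) (B %/ q ^ 2).
  apply: leq_trans (_ : \sum_(2 <= q < B.+1) count (dvdn (q ^ 2)) (iota 1 B) <= _); last first.
    rewrite big_nat [X in _ <= X]big_nat; apply: leq_sum => q /andP[q2 _].
    by rewrite count_dvd_le // expn_gt0; lia.
  under eq_bigr do rewrite -sum1_count big_mkcond.
  rewrite exchange_big -sum1_count big_mkcond /= big_seq [X in _ <= X]big_seq.
  apply: leq_sum => n; rewrite mem_iota => /andP[n1 nB]; rewrite add1n ltnS in nB.
  case: ifP => //; rewrite /squarefree -has_predC => /hasP[q].
  rewrite mem_iota /= negbK => /andP[q2 _] qn.
  have qB : q < B.+1 by have := dvdn_leq n1 qn; rewrite expnS expn1; nia.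
  by rewrite (bigD1_seq q) ?mem_index_iota ?q2 ?iota_uniq //= qn.
have := sum_inv_squares B B2; have : (0 <= B%:R * (4 / B%:R) :> rat)%R by rewrite mulr_ge0 ?divr_ge0 ?ler0n.
have := count_predC squarefree (iota 1 B); rewrite size_iota.
move=> e h1 h2.
have h3 : ((\sum_(2 <= q < B.+1) (B %/ q ^ 2))%:R * 4 <= B%:R * 3 :> rat)%R by rewrite mulrBr in h2; lra.
rewrite -!natrM ler_nat in h3; lia.
Qed.

(* A squarefree [n] factors as [d * u] with [d] dividing [M] and [u] coprime to
   [M]; this replaces a sieve. *)
Lemma coprime_count M B : 0 < M ->
  B <= 4 * size (divisors M) * count (coprime^~ M) (iota 1 B).
Proof.
move=> M0; apply: leq_trans (squarefree_count B) _; rewrite -mulnA leq_mul2l /=.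
rewrite -!size_filter.
have : {subset [seq n <- iota 1 B | squarefree n] <=
    [seq d * u | d <- divisors M, u <- [seq u <- iota 1 B | coprime u M]]}.
  move=> n; rewrite mem_filter mem_iota => /andP[sf /andP[n0 nB]].
  have [d [u [dM uM e]]] := squarefree_split M0 n0 sf.
  apply/allpairsP; exists (d, u); split => //=; first by rewrite -dvdn_divisors.
  rewrite mem_filter uM mem_iota; move: n0 nB; rewrite e muln_gt0 => /andP[d0 u0]; nia.
move/uniq_leq_size; rewrite size_allpairs; apply; by rewrite filter_uniq ?iota_uniq.
Qed.

Local Open Scope ring_scope.

(** * Weil's bound for additive character sums over a prime field *)

(** The reciprocal of the monic polynomial with roots [rs], that is, the shape of an L-function with
    inverse roots [rs]. Its coefficients are the signed elementary symmetric functions. *)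
Definition rev_prod (R : comNzRingType) (rs : seq R) : {poly R} :=
  \prod_(r <- rs) (1 - r *: 'X).

Definition psum (R : comNzRingType) (rs : seq R) (k : nat) : R :=
  \sum_(r <- rs) r ^+ k.

Lemma coef_rev_prod_cons (R : comNzRingType) (r : R) (rs : seq R) (k : nat) :
  (rev_prod (r :: rs))`_k.+1 = (rev_prod rs)`_k.+1 - r * (rev_prod rs)`_k.
Proof. by rewrite /rev_prod big_cons mulrBl mul1r coefB -scalerAl coefZ coefXM. Qed.

Lemma coef0_rev_prod (R : comNzRingType) (rs : seq R) : (rev_prod rs)`_0 = 1.
Proof.
elim: rs => [|r rs IH]; first by rewrite /rev_prod big_nil coef1.
by rewrite /rev_prod big_cons mulrBl mul1r coefB -scalerAl coefZ coefXM mulr0 subr0.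
Qed.

(** Induction on the list: prepending r adds the powers r^(k - i), whose weighted sum telescopes to
    r times one coefficient. Nothing is divided by k, so the identity serves in characteristic p
    (roots of polynomials over F_p) as well as over C (inverse roots of the L-function). *)
Lemma newton_identity (R : comNzRingType) (rs : seq R) (k : nat) :
  \sum_(i < k) (rev_prod rs)`_i * psum rs (k - i) = - (k%:R * (rev_prod rs)`_k).
Proof.
elim: rs k => [|r rs IH] k.
  rewrite big1 => [|i _]; last by rewrite /psum big_nil mulr0.
  by case: k => [|k]; rewrite ?mul0r ?oppr0 // /rev_prod big_nil coef1 mulr0 oppr0.
case: k => [|k]; first by rewrite big_ord0 mul0r oppr0.
pose a i := (rev_prod rs)`_i.
have ps j : psum (r :: rs) j = r ^+ j + psum rs j by rewrite /psum big_cons.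
have IHk := IH k.+1; have IHk' := IH k.
have Hl : \sum_(i < k.+1) (rev_prod (r :: rs))`_i * r ^+ (k.+1 - i) = r * a k.
  elim: (k) => [|m IHm].
    by rewrite big_ord_recl big_ord0 /= !coef0_rev_prod /a coef0_rev_prod mul1r mulr1 addr0.
  rewrite big_ord_recr /= subSnn expr1 coef_rev_prod_cons -/(a _).
  have -> : \sum_(i < m.+1) (rev_prod (r :: rs))`_i * r ^+ (m.+2 - i) = r * (r * a m).
    rewrite -IHm mulr_sumr; apply: eq_bigr => i _.
    by rewrite mulrCA -exprS subSn // ltnW.
  by rewrite -/(a m); ring.
have Hr : \sum_(i < k.+1) (rev_prod (r :: rs))`_i * psum rs (k.+1 - i) =
    \sum_(i < k.+1) a i * psum rs (k.+1 - i) - r * \sum_(i < k) a i * psum rs (k - i).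
  rewrite big_ord_recl [in RHS]big_ord_recl /= /a !coef0_rev_prod -addrA; congr (_ + _).
  rewrite mulr_sumr -sumrB; apply: eq_bigr => i _.
  by rewrite /bump /= add1n coef_rev_prod_cons subSS mulrBl mulrA.
under eq_bigr do rewrite ps mulrDr.
rewrite big_split /= Hl Hr IHk IHk' coef_rev_prod_cons /a -[in k.+1%:R]addn1 natrD; ring.
Qed.

Lemma coef_prod_XsubC_rev (R : comNzRingType) (rs : seq R) (k : nat) :
  (k <= size rs)%N -> (\prod_(r <- rs) ('X - r%:P))`_(size rs - k) = (rev_prod rs)`_k.
Proof.
elim: rs k => [|r rs IH] k.
  by rewrite leqn0 => /eqP ->; rewrite /rev_prod !big_nil.
case: k => [_|k Hk].
  rewrite coef0_rev_prod subn0 /=.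
  have := monic_prod_XsubC (r :: rs) predT id.
  by rewrite monicE lead_coefE size_prod_XsubC => /eqP.
rewrite big_cons mulrBl coefB coefXM mul_polyC coefZ coef_rev_prod_cons /= subSS.
have -> : (\prod_(j <- rs) ('X - j%:P))`_(size rs - k) = (rev_prod rs)`_k by exact: IH.
congr (_ - _).
move: Hk; rewrite /= ltnS leq_eqVlt => /orP[/eqP -> | Hk].
  rewrite subnn /=; symmetry; apply: nth_default.
  rewrite /rev_prod; elim: (rs) => [|b l IHl] /=; first by rewrite big_nil size_poly1.
  rewrite big_cons; apply: leq_trans (size_polyMleq _ _) _.
  have : (size (1 - b *: 'X)%R <= 2)%N.
    apply: leq_trans (size_polyD _ _) _; rewrite geq_max size_poly1 size_polyN /=.
    by apply: leq_trans (size_scale_leq _ _) _; rewrite size_polyX.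
  by move=> H2; rewrite -subn1 leq_subLR; apply: leq_trans (leq_add H2 IHl) _; rewrite !addSn add0n addnS.
have -> : (size rs - k == 0)%N = false by lia.
by rewrite -subnS IH.
Qed.

Lemma exists_linear_relation (K : fieldType) (I J : finType) (A : I -> J -> K) :
  (#|J| < #|I|)%N ->
  exists c : I -> K, (exists i, c i != 0) /\ forall j, \sum_i c i * A i j = 0.
Proof.
move=> ltJI.
pose M := \matrix_(i < #|I|, j < #|J|) A (enum_val i) (enum_val j).
have : kermx M != 0.
  by rewrite -mxrank_eq0 mxrank_ker subn_eq0 -ltnNge (leq_ltn_trans (rank_leq_col M)).
case/rowV0Pn => v /sub_kermxP vM0 v0.
exists (fun i => v 0 (enum_rank i)); split.
  case/rV0Pn: v0 => k vk; exists (enum_val k); by rewrite enum_valK.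
move=> j.
have := congr1 (fun B : 'rV_#|J| => B 0 (enum_rank j)) vM0; rewrite !mxE.
apply: etrans; rewrite (reindex (@enum_rank I)) /=; last exact: onW_bij (enum_rank_bij I).
by apply: eq_bigr => i _; rewrite mxE !enum_rankK.
Qed.

Lemma pole_order_inj (p d j j' a a' : nat) :
  (1 < p)%N -> (0 < d)%N -> coprime p d ->
  (j < p)%N -> (j' < p)%N -> (p * a + d * j)%N = (p * a' + d * j')%N -> j = j' /\ a = a'.
Proof.
move=> p_gt1 d_gt0 co_pd.
wlog lejj : j j' a a' / (j <= j')%N => [hw jp jp' e|].
  have [/hw|/ltnW /hw] := leqP j j'; first exact.
  by case/(_ a' a jp' jp (esym e)).
move=> jp j'p e.
have : (p %| d * (j' - j))%N.
  by apply/dvdnP; exists (a - a')%N; rewrite mulnBr mulnBl [(a * p)%N]mulnC [(a' * p)%N]mulnC; lia.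
rewrite Gauss_dvdr // => /dvdnP[c Hc].
have jj : j = j' by case: c Hc => [|c]; rewrite ?mulSn; lia.
split=> //; apply/eqP; rewrite -(eqn_pmul2l (ltnW p_gt1)); apply/eqP.
by move: e; rewrite jj; lia.
Qed.

(* Elements of the coordinate ring [K[x, y] / (y^p - y - F(x))] are written
   [\sum_(j < p) (G j) y^j] with [G : nat -> {poly K}]; the monomial [x^a y^j]
   has pole order [p * a + d * j] at infinity. *)
Section ArtinSchreierRing.
Variables (K : fieldType) (p d : nat) (F : {poly K}).
Hypotheses (p_gt1 : (1 < p)%N) (szF : size F = d.+1) (d_gt0 : (0 < d)%N)
  (co_pd : coprime p d).

(** Multiplication by y, with the overflow y^p rewritten as y + F. *)
Definition as_mulY (G : nat -> {poly K}) (j : nat) : {poly K} :=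
  if j == 0 then G p.-1 * F else if j == 1 then G 0 + G p.-1 else G j.-1.

Definition as_monomial (a b : nat) : nat -> {poly K} :=
  iter b as_mulY (fun j => if j == 0 then 'X^a else 0).

Definition as_eval (G : nat -> {poly K}) (x y : K) : K :=
  \sum_(j < p) (G j).[x] * y ^+ j.

Definition pole_order (G : nat -> {poly K}) (w : nat) : Prop :=
  (forall j a, (j < p)%N -> (w < p * a + d * j)%N -> (G j)`_a = 0) /\
  (exists j a, [/\ (j < p)%N, (p * a + d * j)%N = w & (G j)`_a != 0]).

Lemma as_eval_mulY G x y :
  y ^+ p - y = F.[x] -> as_eval (as_mulY G) x y = y * as_eval G x y.
Proof using p_gt1.
clear szF d_gt0 co_pd.
move=> /eqP; rewrite subr_eq => /eqP yp; rewrite /as_eval.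
have [p' Ep] : exists p', p = p'.+2 by exists p.-2; case: p p_gt1 => [|[]].
rewrite Ep /= in yp *.
rewrite [LHS]big_ord_recl [X in _ + X = _]big_ord_recl [in RHS]big_ord_recr [in RHS]big_ord_recl.
rewrite /as_mulY /= hornerM hornerD !expr0 !mulr1 /bump /= !add1n.
under eq_bigr => i _ do rewrite !add1n exprS mulrCA /=.
under [in RHS]eq_bigr => i _ do rewrite add1n /=.
rewrite -mulr_sumr; set S := \sum_(i < p') _.
have yp' : y * y ^+ p'.+1 = F.[x] + y by rewrite -exprS.
by rewrite Ep /= expr1 !mulrDr [y * (_ * y ^+ _)]mulrCA yp'; ring.
Qed.

Lemma as_eval_monomial a b x y :
  y ^+ p - y = F.[x] -> as_eval (as_monomial a b) x y = x ^+ a * y ^+ b.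
Proof using p_gt1.
move=> yF; elim: b => [|b IH] /=; last by rewrite as_eval_mulY // IH exprS mulrCA.
rewrite /as_eval -(prednK (ltnW p_gt1)) big_ord_recl big1 => [|i _] /=.
  by rewrite hornerXn expr0 addr0.
by rewrite horner0 mul0r.
Qed.

(** The leading monomial x^a y^j becomes x^a y^(j + 1) or, if j = p - 1, the leading monomial x^(a +
    d) of x^a F. The order grows by d in both cases, since p d = d (p - 1) + d. *)
Lemma pole_order_mulY G w : pole_order G w -> pole_order (as_mulY G) (w + d).
Proof.
move=> [G0 [j [a [jp eqw Ga]]]].
have Fbig i : (d < i)%N -> F`_i = 0 by move=> di; rewrite nth_default // szF.
have Fd : F`_d != 0.
  by have := lead_coef_eq0 F; rewrite lead_coefE szF /= => ->; rewrite -size_poly_eq0 szF.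
split.
  move=> i b ip ltw; rewrite /as_mulY; case: eqP => [i0|/eqP i0].
    rewrite coefM big1 // => k _.
    have [lebk|ltkb] := leqP (b - k) d; last by rewrite Fbig ?mulr0.
    rewrite G0 ?mul0r //; first by lia.
    have := ltn_ord k; nia.
  case: eqP => [i1|/eqP i1].
    by rewrite coefD !G0 ?addr0 //; nia.
  by apply: G0; nia.
have [jp1|jp1] := eqVneq j p.-1.
  exists 0%N, (a + d)%N; split; [lia | nia |].
  rewrite /as_mulY eqxx coefM (bigD1 (inord a)) //= inordK; last by lia.
  rewrite addKn big1 ?addr0 -?jp1 ?mulf_neq0 // => k kNa.
  have kNa' : k != a :> nat by apply: contra_neq kNa => ka; apply: val_inj; rewrite /= inordK //; lia.
  have [ltka|leak] := ltnP k a; first by rewrite Fbig ?mulr0 //; lia.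
  by rewrite G0 ?mul0r // -eqw; nia.
exists j.+1, a; split; [lia | nia |].
rewrite /as_mulY /=; case: (j.+1 =P 1%N) => [[j0]|_] //.
(* For j = 0 the new coefficient of y also receives [G p.-1], but a term of it at this exponent
   would have pole order above w. *)
subst j; rewrite coefD [X in _ + X]G0 ?addr0 //; first lia.
by rewrite -eqw; nia.
Qed.

Lemma pole_order_monomial a b : pole_order (as_monomial a b) (p * a + d * b).
Proof.
elim: b => [|b IH] /=; last by rewrite mulnS addnCA addnC; apply: pole_order_mulY.
split.
  move=> j i jp ltw; case: (j =P 0%N) => [j0|_]; last by rewrite coef0.
  by rewrite coefXn; case: (i =P a) => // ia; move: ltw; rewrite j0 ia ltnn.
by exists 0%N, a; split; [lia | | rewrite /= coefXn eqxx oner_neq0].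
Qed.

(** Among the terms with nonzero coefficient, the one of largest pole order has a leading monomial
    that no other term can cancel. *)
Lemma distinct_pole_orders_free (I : finType) (G : I -> nat -> {poly K})
    (w : I -> nat) (c : I -> K) :
  (forall i, pole_order (G i) (w i)) -> injective w ->
  (exists i, c i != 0) ->
  exists2 j, (j < p)%N & \sum_i c i *: G i j != 0.
Proof.
move=> HG w_inj [i0 ci0].
case: (@arg_maxnP I i0 (fun i => c i != 0) w ci0) => i ci imax.
have [_ [j [a [jp eqw Ga]]]] := HG i.
exists j => //; apply/eqP => /(congr1 (fun q : {poly K} => q`_a)).
rewrite coef0 coef_sum (bigD1 i) //= coefZ big1 => [|k ki].
  by rewrite addr0; apply/eqP; rewrite mulf_neq0.
rewrite coefZ; have [->|ck] := eqVneq (c k) 0; first by rewrite mul0r.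
have [Gk _] := HG k; rewrite Gk ?mulr0 // eqw.
have /= lekj := imax k ck; rewrite ltn_neqAle lekj andbT.
by apply: contra_neq ki => /w_inj.
Qed.

End ArtinSchreierRing.

(** * Stepanov's method in characteristic p *)

Lemma expr_sum_pchar (R : comNzRingType) (n : nat) (I : Type) (r : seq I)
    (P : pred I) (E : I -> R) :
  (0 < n)%N -> [pchar R].-nat n ->
  (\sum_(i <- r | P i) E i) ^+ n = \sum_(i <- r | P i) E i ^+ n.
Proof.
move=> n_gt0 charRn; apply: (big_morph (fun x => x ^+ n)).
  by move=> x y; rewrite exprDn_pchar.
by rewrite expr0n eqn0Ngt n_gt0.
Qed.

Lemma natr_inj_pchar (R : nzRingType) (p m n : nat) :
  p \in [pchar R] -> (m < p)%N -> (n < p)%N -> m%:R = n%:R :> R -> m = n.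
Proof.
move=> charRp; wlog le_mn : m n / (m <= n)%N => [hw|] mp np e.
  by have [/hw|/ltnW /hw] := leqP m n => -> //.
have : (p %| n - m)%N by rewrite (dvdn_pcharf charRp) natrB // e subrr.
by rewrite /dvdn modn_small; lia.
Qed.

Lemma closed_field_root_exists (K : closedFieldType) (n : nat) (z : K) :
  (0 < n)%N -> exists y, y ^+ n == z.
Proof.
move=> n_gt0; have /closed_rootP[y] : size ('X^n - z%:P) != 1.
  by rewrite size_XnsubC //; case: (n) n_gt0.
by rewrite /root !hornerE subr_eq0 => yz; exists y.
Qed.

Section Stepanov.
Variables (K : closedFieldType) (p d k : nat) (F : {poly K}).
Hypotheses (charKp : p \in [pchar K]) (szF : size F = d.+1) (d_gt0 : (0 < d)%N)
  (co_pd : coprime p d).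

Let P := (p ^ k.+1)%N.
Hypothesis P_big : (p ^ 2 * d ^ 2 + 2 * p * d < P)%N.

(* Bombieri's form of Stepanov's method: with [s], [t] ranging over monomials,
   coefficients [c] are chosen such that [\sum c_(s,t)^P s^P t] vanishes
   identically, while [g = \sum c_(s,t) s t^P] does not, its terms having
   distinct pole orders. At a point rational over the field with [P^2] elements
   the first sum is the [P]-th power of the second one, so [g] vanishes there.
   Rational points come in full fibres [(x, y + i)], [i < p], hence every
   coefficient [gs j] of [g] vanishes at [x], and no multiplicity is needed. *)
Theorem stepanov_bound (zs : seq K) :
  uniq zs ->
  (forall x, x \in zs -> x ^+ (P * P) = x /\
     exists2 y, y ^+ p - y = F.[x] & y ^+ (P * P) = y) ->
  (p * size zs <= P * P + 2 * p * d * P)%N.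
Proof.
move=> zs_uniq zsP.
have p_pr := pcharf_prime charKp.
have p_gt1 := prime_gt1 p_pr; have p_gt0 := ltnW p_gt1.
pose P1 := (p ^ k)%N; have PE : P = (p * P1)%N by rewrite /P expnS.
have P_gt0 : (0 < P)%N by rewrite expn_gt0 p_gt0.
have charP : [pchar K].-nat P by rewrite pnatX /= pnatE // charKp.
have dP1 : (d <= P1)%N.
  by rewrite -(leq_pmul2l p_gt0) -PE; apply: leq_trans (ltnW P_big); rewrite -mulnA; lia.
(* Taking al = P1 - d keeps the pole order of s below P = p P1, so the pole order of s t^P gives
   back those of s and t as its digits in base P. Taking be = P1 + d yields al be p^2 = P^2 - (p
   d)^2 unknowns, which by [P_big] exceeds the number A p of coefficients of the sum of the s^P
   t. *)
pose al := (P1 - d)%N; pose be := (P1 + d)%N.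
pose I := (('I_al * 'I_p) * ('I_be * 'I_p))%type.
pose A := (P * (P1 - 1) + (P1 + 2 * d))%N.
have F_pole := pole_order_monomial p_gt1 szF d_gt0 co_pd.
pose h (i : I) := as_monomial p F (P * i.1.1 + i.2.1) (P * i.1.2 + i.2.2).
pose g (i : I) := as_monomial p F (i.1.1 + P * i.2.1) (i.1.2 + P * i.2.2).
pose wg (i : I) := (p * (i.1.1 + P * i.2.1) + d * (i.1.2 + P * i.2.2))%N.
have h_big i (j a : nat) : (j < p)%N -> (A <= a)%N -> (h i j)`_a = 0.
  move=> jp leAa; have [h0 _] := F_pole (P * i.1.1 + i.2.1)%N (P * i.1.2 + i.2.2)%N.
  apply: h0 => //; case: i => [[i1 j1] [i2 j2]] /=.
  have Hi1 : (P * (p * i1) + P * p + P * (p * d) <= P * (p * P1))%N.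
    by rewrite -[X in (_ + P * X + _)%N]muln1 -!mulnDr !leq_mul2l; have := ltn_ord i1; rewrite {2}/al; lia.
  have Hj1 : (P * (d * j1) + P * d <= P * (p * d))%N.
    by rewrite -mulnDr -mulnSr leq_mul2l [(p * d)%N]mulnC leq_mul2l ltn_ord !orbT.
  have Hi2 : (p * i2 + p <= p * P1 + p * d)%N by rewrite -mulnSr -mulnDr leq_mul2l ltn_ord orbT.
  have Hj2 : (d * j2 + d <= p * d)%N by rewrite -mulnSr [(p * d)%N]mulnC leq_mul2l ltn_ord orbT.
  have HA : (p * A <= p * a)%N by rewrite leq_mul2l leAa orbT.
  have HA' : (p * A + P * p = P * (p * P1) + P + 2 * (p * d))%N.
    rewrite /A PE; have : (0 < P1)%N by rewrite expn_gt0 p_gt0.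
    by case: (P1) => // P2 _; rewrite subSS subn0; ring.
  rewrite !mulnDr ![(p * (P * _))%N]mulnCA ![(d * (P * _))%N]mulnCA.
  by move: Hi1 Hj1 Hi2 Hj2 HA HA'; lia.
have [|c' [[i0 c'i0] c'0]] := @exists_linear_relation K I ('I_A * 'I_p)%type
    (fun i t => (h i t.2)`_t.1).
  rewrite !card_prod !card_ord.
  have HA' : (A * p + P * p = P * P + P + 2 * (p * d))%N.
    rewrite /A PE; have : (0 < P1)%N by rewrite expn_gt0 p_gt0.
    by case: (P1) => // P2 _; rewrite subSS subn0; ring.
  have -> : (al * p * (be * p) = P * P - (p * d) * (p * d))%N.
    by rewrite /al /be !mulnBl !mulnDl [(P1 * p)%N]mulnC -PE; lia.
  have : (2 * P <= P * p)%N by rewrite mulnC leq_mul2l p_gt1 orbT.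
  have -> : ((p * d) * (p * d) = p ^ 2 * d ^ 2)%N by lia.
  move: HA' P_big; lia.
(* The identity to be forced is linear in the P-th powers of the coefficients. It has been solved
   for these powers, and K contains their roots. *)
have /(@fin_all_exists _ _ _) [c cP] : forall i, exists y, y ^+ P == c' i.
  by move=> i; apply: closed_field_root_exists.
have wg_inj : injective wg.
  move=> [[i1 j1] [i2 j2]] [[i1' j1'] [i2' j2']]; rewrite /wg /= => e.
  have small (i : 'I_al) (j : 'I_p) : (p * i + d * j < P)%N.
    have : (p * i + p + p * d <= p * P1)%N.
      by rewrite -mulnSr -mulnDr leq_mul2l; have := ltn_ord i; rewrite /al; lia.
    have : (d * j + d <= p * d)%N by rewrite -mulnSr [(p * d)%N]mulnC leq_mul2l ltn_ord orbT.
    by rewrite -PE; lia.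
  have e' : ((p * i2 + d * j2) * P + (p * i1 + d * j1) =
             (p * i2' + d * j2') * P + (p * i1' + d * j1'))%N by lia.
  have e1 := congr1 (fun n => n %/ P)%N e'; have e2 := congr1 (fun n => n %% P)%N e'.
  rewrite /= !divnMDl // !divn_small ?addn0 // in e1; rewrite /= !modnMDl !modn_small // in e2.
  have [/val_inj-> /val_inj->] := pole_order_inj p_gt1 d_gt0 co_pd (ltn_ord _) (ltn_ord _) e1.
  by have [/val_inj-> /val_inj->] := pole_order_inj p_gt1 d_gt0 co_pd (ltn_ord _) (ltn_ord _) e2.
have [|j jp gj0] := distinct_pole_orders_free (c := c)
    (fun i => F_pole (i.1.1 + P * i.2.1)%N (i.1.2 + P * i.2.2)%N) wg_inj.
  exists i0; apply: contraNneq c'i0 => ci0.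
  by rewrite -(eqP (cP i0)) ci0 expr0n eqn0Ngt P_gt0.
pose gs j := \sum_i c i *: g i j.
rewrite -/(gs j) in gj0.
have g_vanish x y : y ^+ p - y = F.[x] -> x ^+ (P * P) = x -> y ^+ (P * P) = y ->
    \sum_(j < p) (gs j).[x] * y ^+ j = 0.
  move=> yF xP yP.
  have -> : \sum_(j < p) (gs j).[x] * y ^+ j =
      \sum_i c i * (x ^+ (i.1.1 + P * i.2.1) * y ^+ (i.1.2 + P * i.2.2)).
    under [RHS]eq_bigr => i _ do rewrite -(as_eval_monomial p_gt1 _ _ yF) mulr_sumr.
    rewrite exchange_big; apply: eq_bigr => l _; rewrite horner_sum mulr_suml.
    by apply: eq_bigr => i _; rewrite hornerZ mulrA.
  have P_inj (z : K) : z ^+ P = 0 -> z = 0 by move/eqP; rewrite expf_eq0 => /andP[_ /eqP].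
  apply: P_inj; rewrite expr_sum_pchar //.
  have -> : \sum_i (c i * (x ^+ (i.1.1 + P * i.2.1) * y ^+ (i.1.2 + P * i.2.2))) ^+ P =
     \sum_i c' i * as_eval p (h i) x y.
    apply: eq_bigr => i _; rewrite !exprMn (eqP (cP i)) as_eval_monomial //.
    rewrite -!exprM !mulnDl !exprD ![(P * _ * P)%N]mulnAC !(exprM _ (P * P)%N) xP yP.
    by rewrite ![(_ * P)%N]mulnC.
  rewrite /as_eval; under eq_bigr do rewrite mulr_sumr.
  rewrite exchange_big big1 // => l _.
  under eq_bigr do rewrite mulrA; rewrite -mulr_suml.
  under eq_bigr do rewrite -hornerZ; rewrite -horner_sum.
  have -> : \sum_i c' i *: h i l = 0; last by rewrite horner0 mul0r.
  apply/polyP => a; rewrite coef0 coef_sum.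
  have [ltaA|leAa] := ltnP a A.
    by apply: etrans (c'0 (Ordinal ltaA, l)); apply: eq_bigr => i _; rewrite coefZ.
  by rewrite big1 // => i _; rewrite coefZ h_big ?mulr0.
have gs_root x : x \in zs -> (gs j).[x] = 0.
  move=> /zsP[xP [y yF yP]].
  pose G := \poly_(l < p) (gs l).[x].
  pose ys := [seq y + (l : nat)%:R | l : 'I_p].
  have : G = 0.
    apply: (@roots_geq_poly_eq0 _ _ ys).
    - apply/allP => _ /mapP[l _ ->]; rewrite /root horner_poly.
      have lE n : [pchar K].-nat n -> ((l : nat)%:R : K) ^+ n = (l : nat)%:R.
        move=> charn; elim: (l : nat) => [|m IHm].
          by rewrite expr0n eqn0Ngt; case/andP: charn => ->.
        by rewrite -addn1 natrD exprDn_pchar // IHm expr1n.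
      rewrite g_vanish //.
        by rewrite exprDn_pchar ?lE ?pnatE // -yF; ring.
      by rewrite exprDn_pchar ?lE ?yP // pnatM charP.
    - rewrite map_inj_uniq ?enum_uniq // => l1 l2 /addrI e.
      exact: val_inj (natr_inj_pchar charKp (ltn_ord _) (ltn_ord _) e).
    - by rewrite size_map size_enum_ord size_poly.
  move=> G0; have := congr1 (fun q : {poly K} => q`_j) G0.
  by rewrite coef_poly jp coef0.
have : (size zs < size (gs j))%N.
  rewrite ltnNge; apply: contra gj0 => le_sz; apply/eqP.
  by apply: roots_geq_poly_eq0 zs_uniq le_sz; apply/allP => x /gs_root /eqP.
have : (size (gs j) <= P * P1 + 2 * d * P)%N.
  apply/leq_sizeP => a lea; rewrite coef_sum big1 // => -[[i1 j1] [i2 j2]] _; rewrite coefZ.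
  have [g0 _] := F_pole (i1 + P * i2)%N (j1 + P * j2)%N.
  rewrite g0 ?mulr0 //.
  have Hi1 : (p * i1 + p <= P)%N.
    by rewrite PE -mulnSr leq_mul2l; have := ltn_ord i1; rewrite /al; lia.
  have Hi2 : (P * (p * i2) + P * p <= P * P + P * (p * d))%N.
    by rewrite -!mulnDr leq_mul2l {2}PE -mulnSr -mulnDr leq_mul2l ltn_ord !orbT.
  have Hj1 : (d * j1 + d <= p * d)%N by rewrite -mulnSr [(p * d)%N]mulnC leq_mul2l ltn_ord orbT.
  have Hj2 : (P * (d * j2) + P * d <= P * (p * d))%N.
    by rewrite -mulnDr -mulnSr leq_mul2l [(p * d)%N]mulnC leq_mul2l ltn_ord !orbT.
  have Ha : (P * P + 2 * (P * (p * d)) <= p * a)%N.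
    by apply: leq_trans (leq_mul (leqnn p) lea); rewrite {2}PE; apply/eq_leq; ring.
  have Hp : (p * d <= P)%N by rewrite PE leq_mul2l dP1 orbT.
  have Hp' : (2 * P <= P * p)%N by rewrite mulnC leq_mul2l p_gt1 orbT.
  rewrite !mulnDr [(p * (P * _))%N]mulnCA [(d * (P * _))%N]mulnCA.
  by move: Hi1 Hi2 Hj1 Hj2 Ha Hp Hp'; lia.
move=> le1 lt2; have := leq_mul (leqnn p) (leq_trans (ltnW lt2) le1).
by move/leq_trans; apply; rewrite mulnDr mulnCA -PE; apply/eq_leq; ring.
Qed.
End Stepanov.

(** * Finite fields inside an algebraic closure *)

Lemma dvdp_prod_XsubC_count (K : fieldType) (s t : seq K) :
  \prod_(x <- s) ('X - x%:P) %| \prod_(x <- t) ('X - x%:P) =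
  all (fun z => (count_mem z s <= count_mem z t)%N) s.
Proof.
apply/idP/allP => [dv z _|].
  rewrite -!mu_prod_XsubC mup_geq ?monic_neq0 ?monic_prod_XsubC //.
  by apply: dvdp_trans dv; rewrite -mup_geq ?monic_neq0 ?monic_prod_XsubC.
elim: s t => [|x s IH] t Hc; first by rewrite big_nil dvd1p.
have xt : x \in t.
  by rewrite -has_pred1 has_count; apply: leq_trans (Hc x (mem_head _ _)); rewrite /= eqxx.
rewrite (perm_big _ (perm_to_rem xt)) !big_cons dvdp_mul2l ?polyXsubC_eq0 //.
apply: IH => z zs.
have := Hc z; rewrite inE zs orbT => /(_ isT).
have /permP/(_ (pred1 z)) -> := perm_to_rem xt.
by rewrite /= leq_add2l.
Qed.

Section FrobeniusPoints.
Variables (p : nat) (K : closedFieldType) (io : {rmorphism 'F_p -> K}).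
Hypothesis p_pr : prime p.

Lemma pchar_closure : p \in [pchar K].
Proof. by apply: (rmorph_pchar io); apply: pchar_Fp. Qed.

Lemma pchar_closure_nat n : [pchar K].-nat (p ^ n)%N.
Proof. by rewrite pnatX /= pnatE // pchar_closure. Qed.

(** A left inverse of the embedding, with value 0 off its image. It lets [psi] be applied to
    elements of K known to lie in F_p, such as traces. *)
Definition unio (z : K) : 'F_p := odflt 0 [pick a | io a == z].

Lemma ioK : cancel io unio.
Proof.
move=> a; rewrite /unio; case: pickP => [b /eqP /fmorph_inj -> //|/(_ a)].
by rewrite eqxx.
Qed.

Lemma Fp_frob (a : 'F_p) n : a ^+ (p ^ n) = a.
Proof.
have ap : a ^+ p = a by have := expf_card a; rewrite card_Fp.
elim: n => [|n IH]; first by rewrite expr1.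
by rewrite expnSr exprM IH ap.
Qed.

Lemma io_frob (a : 'F_p) n : io a ^+ (p ^ n) = io a.
Proof. by rewrite -rmorphXn Fp_frob. Qed.

(** The p elements of F_p already exhaust the roots of X^p - X. *)
Lemma unioK (x : K) : x ^+ p = x -> io (unio x) = x.
Proof.
move=> xp; rewrite /unio; case: pickP => [b /eqP //|no].
have p_gt1 := prime_gt1 p_pr.
have szX : size ('X^p - 'X : {poly K}) = p.+1.
  by rewrite size_polyDl ?size_polyXn // size_polyN size_polyX.
have := @max_poly_roots K ('X^p - 'X) (x :: [seq io a | a : 'F_p]).
rewrite -size_poly_eq0 szX /= size_map -cardE card_Fp // ltnn => /(_ isT) F; exfalso.
suff : false by []. apply: F.
  rewrite /root !hornerE xp subrr eqxx /=; apply/allP => _ /mapP[a _ ->].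
  by have := io_frob a 1; rewrite expn1 /root !hornerE => ->; rewrite subrr.
rewrite map_inj_uniq ?enum_uniq ?andbT; last exact: fmorph_inj.
by apply/mapP => -[a _ e]; have := no a; rewrite e eqxx.
Qed.

(** For n > 0 this lists the elements of the subfield of K with p^n elements. Working with lists
    inside one closure avoids constructing the extensions as types. *)
Definition frob_points n : seq K :=
  sval (closed_field_poly_normal ('X^(p ^ n) - 'X)).

Lemma frob_points_poly n : (0 < n)%N ->
  'X^(p ^ n) - 'X = \prod_(z <- frob_points n) ('X - z%:P).
Proof.
move=> n0; rewrite /frob_points; case: closed_field_poly_normal => /= r.
rewrite (_ : lead_coef _ = 1) ?scale1r //.
rewrite lead_coefDl ?lead_coefXn // size_polyN size_polyX size_polyXn ltnS.
by rewrite -[X in (X < _)%N](expn0 p) ltn_exp2l ?prime_gt1.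
Qed.

Lemma mem_frob_points n x : (0 < n)%N -> (x \in frob_points n) = (x ^+ (p ^ n) == x).
Proof.
by move=> n0; rewrite -root_prod_XsubC -frob_points_poly // /root !hornerE subr_eq0.
Qed.

Lemma size_frob_points n : (0 < n)%N -> size (frob_points n) = (p ^ n)%N.
Proof.
move=> n0; have := congr1 (fun q : {poly K} => size q) (frob_points_poly n0).
rewrite size_prod_XsubC size_polyDl ?size_polyXn; first by case.
rewrite size_polyN size_polyX ltnS.
by rewrite -[X in (X < _)%N](expn0 p) ltn_exp2l ?prime_gt1.
Qed.

Lemma frob_points_uniq n : (0 < n)%N -> uniq (frob_points n).
Proof.
move=> n0; rewrite -separable_prod_XsubC -frob_points_poly // unlock.
rewrite derivB derivXn derivX -mulr_natr -polyC_natr natrX (pcharf0 pchar_closure).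
rewrite expr0n gtn_eqF // polyC0 mulr0 sub0r.
by rewrite -[X in coprimep _ X]scaleN1r coprimepZr ?oppr_eq0 ?oner_neq0 // coprimep1.
Qed.

Lemma frobD n x y : ((x + y) ^+ (p ^ n) = x ^+ (p ^ n) + y ^+ (p ^ n) :> K).
Proof. by rewrite exprDn_pchar ?pchar_closure_nat. Qed.

Lemma frobN n x : ((- x) ^+ (p ^ n) = - x ^+ (p ^ n) :> K).
Proof. by rewrite exprNn_pchar ?pchar_closure_nat. Qed.

Lemma frob_inj n : injective (fun x : K => x ^+ (p ^ n)).
Proof.
move=> x y /= /eqP; rewrite -subr_eq0 -frobN -frobD expf_eq0 => /andP[_].
by rewrite subr_eq0 => /eqP.
Qed.

Lemma frob_io_horner (g : {poly 'F_p}) x n :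
  (map_poly io g).[x] ^+ (p ^ n) = (map_poly io g).[x ^+ (p ^ n)].
Proof.
rewrite !horner_coef expr_sum_pchar ?expn_gt0 ?prime_gt0 ?pchar_closure_nat //.
by apply: eq_bigr => i _; rewrite exprMn coef_map io_frob -!exprM mulnC.
Qed.

Definition frob_trace n (z : K) : K := \sum_(i < n) z ^+ (p ^ i).

Lemma frob_traceD n x y : frob_trace n (x + y) = frob_trace n x + frob_trace n y.
Proof. by rewrite -big_split; apply: eq_bigr => i _; rewrite frobD. Qed.

Lemma frob_traceN n x : frob_trace n (- x) = - frob_trace n x.
Proof. by rewrite -sumrN; apply: eq_bigr => i _; rewrite frobN. Qed.

Lemma frob_trace_frob n z : frob_trace n z ^+ p = frob_trace n (z ^+ p).
Proof.
have -> : frob_trace n z ^+ p = \sum_(i < n) (z ^+ (p ^ i)) ^+ p.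
  by apply: expr_sum_pchar; rewrite ?prime_gt0 // -(expn1 p) pchar_closure_nat.
by apply: eq_bigr => i _; rewrite -!exprM mulnC.
Qed.

(* The sum telescopes: this is the additive Hilbert 90 relation. *)
Lemma frob_trace_sub n z : frob_trace n (z ^+ p) - frob_trace n z = z ^+ (p ^ n) - z.
Proof.
rewrite /frob_trace -sumrB.
under eq_bigr => i _ do rewrite -exprM -expnS.
rewrite -(big_mkord xpredT (fun i => z ^+ (p ^ i.+1) - z ^+ (p ^ i))).
by rewrite telescope_sumr.
Qed.

Lemma unio_trace n z : z ^+ (p ^ n) = z -> io (unio (frob_trace n z)) = frob_trace n z.
Proof.
by move=> zn; apply: unioK; apply/eqP; rewrite frob_trace_frob -subr_eq0 frob_trace_sub zn subrr.
Qed.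

End FrobeniusPoints.

(** * The L-function of the character sum *)

Section LFunction.
Variables (p : nat) (K : closedFieldType) (io : {rmorphism 'F_p -> K}).
Hypothesis p_pr : prime p.

Local Notation unio := (unio io).

Definition closure_roots (D : {poly 'F_p}) : seq K :=
  sval (closed_field_poly_normal (map_poly io D)).

Lemma closure_rootsE D : D \is monic ->
  map_poly io D = \prod_(z <- closure_roots D) ('X - z%:P).
Proof.
move=> mD; rewrite /closure_roots; case: closed_field_poly_normal => /= r.
by rewrite lead_coef_map (monicP mD) rmorph1 scale1r.
Qed.

Lemma size_closure_roots D n : D \is monic -> size D = n.+1 -> size (closure_roots D) = n.
Proof.
move=> mD szD; have := congr1 (fun q : {poly K} => size q) (closure_rootsE mD).
by rewrite size_map_poly szD size_prod_XsubC => -[].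
Qed.

Lemma closure_roots_coef D n k : D \is monic -> size D = n.+1 -> (k <= n)%N ->
  (rev_prod (closure_roots D))`_k = io D`_(n - k).
Proof.
move=> mD szD kn; have szr := size_closure_roots mD szD.
by rewrite -coef_prod_XsubC_rev szr // -closure_rootsE // coef_map.
Qed.

Lemma rev_prod_big (R : comNzRingType) (rs : seq R) k :
  (size rs < k)%N -> (rev_prod rs)`_k = 0.
Proof.
elim: rs k => [|r rs IH] [|k] //= sk; first by rewrite /rev_prod big_nil coef1.
by rewrite coef_rev_prod_cons !IH ?mulr0 ?subr0 // ltnW.
Qed.

Lemma psum_recursion (R : comNzRingType) (rs : seq R) k :
  psum rs k.+1 = - (k.+1%:R * (rev_prod rs)`_k.+1) -
    \sum_(i < k) (rev_prod rs)`_i.+1 * psum rs (k - i).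
Proof.
by rewrite -newton_identity big_ord_recl /= coef0_rev_prod mul1r addrK.
Qed.

Lemma psum0 (R : comNzRingType) (rs : seq R) : psum rs 0 = (size rs)%:R.
Proof. by rewrite /psum; under eq_bigr do rewrite expr0; rewrite big_const_seq count_predT iter_addr_0. Qed.

(** Newton's recursion expresses the power sums through the coefficients of D without division, so
    they stay in F_p. *)
Lemma closure_psum_rational D k : D \is monic ->
  exists a, psum (closure_roots D) k = io a.
Proof.
move=> mD; have [n szD] : exists n, size D = n.+1.
  by exists (size D).-1; rewrite prednK // size_poly_gt0 monic_neq0.
have aP j : exists a, (rev_prod (closure_roots D))`_j = io a.
  have [jn|nj] := leqP j n; first by exists (D`_(n - j)); rewrite (closure_roots_coef mD szD).
  by exists 0; rewrite rmorph0 rev_prod_big // (size_closure_roots mD szD).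
elim/ltn_ind: k => -[|k] IH.
  by exists (size (closure_roots D))%:R; rewrite psum0 rmorph_nat /=.
rewrite psum_recursion.
have [b ->] : exists b, \sum_(i < k) (rev_prod (closure_roots D))`_i.+1 *
    psum (closure_roots D) (k - i) = io b.
  apply: (big_ind (fun s => exists b, s = io b)).
  - by exists 0; rewrite rmorph0.
  - by move=> _ _ [x ->] [y ->]; exists (x + y); rewrite rmorphD.
  - move=> i _; have [x ->] := aP i.+1; have [|y ->] := IH (k - i)%N; first by rewrite ltnS leq_subr.
    by exists (x * y); rewrite rmorphM.
have [c ->] := aP k.+1; exists (- (k.+1%:R * c) - b).
by rewrite rmorphB rmorphN rmorphM rmorph_nat.
Qed.

Variable f : {poly 'F_p}.

Definition root_sum (D : {poly 'F_p}) : K :=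
  \sum_(r <- closure_roots D) (map_poly io f).[r].

Lemma root_sumE D :
  root_sum D = \sum_(i < size f) io f`_i * psum (closure_roots D) i.
Proof.
rewrite /root_sum; under eq_bigr => r _ do rewrite horner_coef size_map_poly.
rewrite exchange_big; apply: eq_bigr => i _.
by rewrite /psum mulr_sumr; apply: eq_bigr => r _; rewrite coef_map.
Qed.

Lemma unio_root_sum D : D \is monic -> io (unio (root_sum D)) = root_sum D.
Proof.
move=> mD; suff [a ->] : exists a, root_sum D = io a by rewrite ioK.
rewrite root_sumE; apply: (big_ind (fun s => exists b, s = io b)).
- by exists 0; rewrite rmorph0.
- by move=> _ _ [x ->] [y ->]; exists (x + y); rewrite rmorphD.
- move=> i _; have [x ->] := closure_psum_rational i mD.
  by exists (f`_i * x); rewrite rmorphM.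
Qed.

Lemma root_sumM D1 D2 : D1 \is monic -> D2 \is monic ->
  root_sum (D1 * D2) = root_sum D1 + root_sum D2.
Proof.
move=> m1 m2; rewrite /root_sum -big_cat /=; apply: perm_big.
by apply: prod_XsubC_eq; rewrite big_cat /= -!closure_rootsE ?rpredM // rmorphM.
Qed.

Variables (C : numClosedFieldType) (psi : 'F_p -> C).
Hypotheses (psiD : forall a b, psi (a + b) = psi a * psi b) (psi0 : psi 0 = 1).

(** The completely multiplicative function on monic polynomials whose generating series in the
    degree is the L-function. *)
Definition lam (D : {poly 'F_p}) : C := psi (unio (root_sum D)).

Lemma lamM D1 D2 : D1 \is monic -> D2 \is monic -> lam (D1 * D2) = lam D1 * lam D2.
Proof.
move=> m1 m2; rewrite /lam -psiD; congr psi; apply: (fmorph_inj io).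
by rewrite rmorphD !unio_root_sum ?rpredM // root_sumM.
Qed.

(** The lower coefficients as a row vector: sums over the monic polynomials of degree n become sums
    over a finite type, which can be reindexed by translations. *)
Definition monic_poly n (v : 'rV['F_p]_n) : {poly 'F_p} := 'X^n + rVpoly v.

Lemma size_monic_poly n v : size (@monic_poly n v) = n.+1.
Proof. by rewrite size_polyDl ?size_polyXn // ltnS size_poly. Qed.

Lemma monic_monic_poly n v : @monic_poly n v \is monic.
Proof.
by rewrite monicE lead_coefDl ?lead_coefXn // size_polyXn ltnS size_poly.
Qed.

Lemma monic_poly_coef n (v : 'rV_n) i (ltin : (i < n)%N) :
  (monic_poly v)`_i = v 0 (Ordinal ltin).
Proof. by rewrite coefD coefXn ltn_eqF // add0r -(coef_rVpoly_ord v (Ordinal ltin)). Qed.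

Lemma monic_poly_inj n : injective (@monic_poly n).
Proof. by move=> v w /addrI/(can_inj (@rVpolyK _ _)). Qed.

Lemma monic_polyP n D : D \is monic -> size D = n.+1 -> exists v, D = @monic_poly n v.
Proof.
move=> mD szD; exists (poly_rV (D - 'X^n)); rewrite /monic_poly poly_rV_K; first by rewrite addrC subrK.
apply/leq_sizeP => j; rewrite leq_eqVlt coefB coefXn => /orP[/eqP <-|ltnj].
  by rewrite eqxx; move/monicP: mD; rewrite lead_coefE szD => ->; rewrite subrr.
by rewrite nth_default ?szD // gtn_eqF // subr0.
Qed.

Definition Lcoef n : C := \sum_(v : 'rV['F_p]_n) lam (monic_poly v).

Lemma Lcoef0 : Lcoef 0 = 1.
Proof.
rewrite /Lcoef (big_pred1 0) => [|v]; last by rewrite [v]thinmx0 /= eqxx.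
have m1 := monic_monic_poly (0 : 'rV['F_p]_0).
have : closure_roots (monic_poly (0 : 'rV['F_p]_0)) = [::].
  by apply: size0nil; apply: size_closure_roots (size_monic_poly _).
by rewrite /lam /root_sum => ->; rewrite big_nil -(rmorph0 io) ioK psi0.
Qed.

(* Adding [de] to the coefficient of [X^(n - d)] leaves the power sums of the
   roots of exponent less than [d] unchanged and shifts the [d]-th one by
   [- d * de] (Newton). *)
Lemma Lcoef_eq0 d n :
  (exists a, psi a != 1) -> size f = d.+1 -> (0 < d < p)%N -> (d <= n)%N -> Lcoef n = 0.
Proof.
move=> [a psia] szf /andP[d0 dp] dn.
have fd : f`_d != 0 by have := lead_coef_eq0 f; rewrite lead_coefE szf /= => ->; rewrite -size_poly_eq0 szf.
have dF : (d%:R : 'F_p) != 0.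
  by rewrite -(dvdn_pcharf (pchar_Fp p_pr)) gtnNdvd.
have ltnd : (n - d < n)%N by lia.
(* Solves - d de f_d = a, so that the shift multiplies [lam] by [psi a]; d is invertible because 0 <
   d < p. *)
pose de := - (a / (d%:R * f`_d)).
pose u : 'rV['F_p]_n := de *: delta_mx 0 (Ordinal ltnd).
have Hlam v : lam (monic_poly (v + u)) = lam (monic_poly v) * psi a.
  rewrite /lam -psiD; congr psi; apply: (fmorph_inj io).
  rewrite rmorphD !unio_root_sum ?monic_monic_poly //.
  set r1 := closure_roots (monic_poly (v + u)); set r2 := closure_roots (monic_poly v).
  have coefE k : (k <= n)%N -> (rev_prod r1)`_k = (rev_prod r2)`_k + (io de) *+ (k == d).
    move=> kn; rewrite /r1 /r2 !(closure_roots_coef (n:=n)) ?monic_monic_poly ?size_monic_poly //.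
    case: k kn => [|k] kn.
      rewrite subn0 eq_sym (gtn_eqF d0) mulr0n addr0.
      by rewrite /monic_poly !coefD !coefXn eqxx ![(rVpoly _)`_n]nth_default ?size_poly.
    have ltk : (n - k.+1 < n)%N by lia.
    rewrite !(monic_poly_coef _ ltk) !mxE rmorphD eqxx /=; congr (_ + _).
    rewrite -val_eqE /= (_ : (n - k.+1 == n - d)%N = (k.+1 == d)%N); last by lia.
    by case: eqP; rewrite ?mulr1 // ?mulr0 ?rmorph0.
  have Hps k : (0 < k < d)%N -> psum r1 k = psum r2 k.
    elim/ltn_ind: k => -[|k] // IH /andP[_ kd].
    rewrite !psum_recursion coefE ?(ltn_eqF kd) ?addr0; last by lia.
    congr (_ - _); apply: eq_bigr => i _; have ik := ltn_ord i.
    by rewrite coefE ?(ltn_eqF (_ : i.+1 < d)%N) ?addr0 ?IH //; lia.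
  have Hpd : psum r1 d = psum r2 d - d%:R * io de.
    case: (d) d0 dn coefE Hps => // m _ mn cE HP.
    rewrite !psum_recursion cE // eqxx mulr1n.
    have -> : \sum_(i < m) (rev_prod r1)`_i.+1 * psum r1 (m - i) =
              \sum_(i < m) (rev_prod r2)`_i.+1 * psum r2 (m - i).
      apply: eq_bigr => i _; have ik := ltn_ord i.
      by rewrite cE ?(ltn_eqF (_ : i.+1 < m.+1)%N) ?addr0 ?HP //; lia.
    ring.
  rewrite !root_sumE -/r1 -/r2 szf !big_ord_recr /= Hpd mulrBr addrA.
  have -> : \sum_(i < d) io f`_i * psum r1 i = \sum_(i < d) io f`_i * psum r2 i.
    apply: eq_bigr => -[[|i] /= id] _; last by rewrite Hps // id.
    congr (_ * _); rewrite !psum0.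
    by rewrite /r1 /r2 !(size_closure_roots (monic_monic_poly _) (size_monic_poly _)).
  congr (_ + _); rewrite -(rmorph_nat io) -!rmorphM -rmorphN; congr (io _).
  by rewrite /de; field; rewrite fd dF.
have : Lcoef n = Lcoef n * psi a.
  rewrite {1}/Lcoef (reindex_inj (addIr u)) /= /Lcoef mulr_suml.
  by apply: eq_bigr => v _; exact: Hlam.
move/eqP; rewrite -{1}[Lcoef n]mulr1 -subr_eq0 -mulrBr mulf_eq0 => /orP[/eqP //|].
by rewrite subr_eq0 eq_sym (negPf psia).
Qed.

End LFunction.

(** * Norms of points of the extensions *)

Lemma map_iota_shift (T : Type) (f : nat -> T) j :
  [seq f i.+1 | i <- iota 0 j.+1] = rcons (behead [seq f i | i <- iota 0 j.+1]) (f j.+1).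
Proof.
rewrite /= -map_rcons -cats1 -[[:: j.+1]]/(iota (1 + j) 1) -iotaD addn1 /=.
by rewrite (iotaDl 1 1 j) -map_comp.
Qed.

Section Norms.
Variables (p : nat) (K : closedFieldType) (io : {rmorphism 'F_p -> K}).
Hypothesis p_pr : prime p.

Local Notation unio := (unio io).
Local Notation frob_points := (frob_points p K).
Local Notation frob := (pFrobenius_aut (pchar_closure io p_pr)).

Definition frob_orbit j (x : K) : seq K := [seq x ^+ (p ^ i) | i <- iota 0 j].

(** The norm of X - x from the field with p^j elements, that is, the characteristic polynomial of x
    over F_p. Applying [unio] to the coefficients loses nothing once x lies in that field. *)
Definition frob_norm j (x : K) : {poly 'F_p} :=
  map_poly unio (\prod_(z <- frob_orbit j x) ('X - z%:P)).

Lemma size_frob_orbit j x : size (frob_orbit j x) = j.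
Proof. by rewrite size_map size_iota. Qed.

Lemma frob_orbit_rot j x : x ^+ (p ^ j) = x ->
  perm_eq [seq frob z | z <- frob_orbit j x] (frob_orbit j x).
Proof.
move=> xj; case: j xj => // j xj.
have -> : [seq frob z | z <- frob_orbit j.+1 x] = rcons (behead (frob_orbit j.+1 x)) x.
  have -> : [seq frob z | z <- frob_orbit j.+1 x] = [seq x ^+ (p ^ i.+1) | i <- iota 0 j.+1].
    by rewrite -map_comp; apply: eq_map => i /=; rewrite pFrobenius_autE -exprM -expnSr.
  by rewrite (map_iota_shift (fun i => x ^+ (p ^ i))) xj.
by rewrite perm_rcons.
Qed.

(** Frobenius permutes the orbit cyclically, so it fixes the coefficients of the product. *)
Lemma frob_norm_io j x : x ^+ (p ^ j) = x ->
  map_poly io (frob_norm j x) = \prod_(z <- frob_orbit j x) ('X - z%:P).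
Proof.
move=> xj; set Q := \prod_(z <- _) _.
have Qfix : map_poly frob Q = Q.
  rewrite map_prod_XsubC -(big_map frob predT (fun z => 'X - z%:P)).
  by apply: perm_big; apply: frob_orbit_rot.
have unio0 : unio 0 = 0 by rewrite -(rmorph0 io) ioK.
apply/polyP => i; rewrite coef_map /frob_norm coef_map_id0 //=. apply: (unioK io p_pr).
by have := congr1 (fun q : {poly K} => q`_i) Qfix; rewrite coef_map.
Qed.

Lemma monic_frob_norm j x : x ^+ (p ^ j) = x -> frob_norm j x \is monic.
Proof.
move=> xj; rewrite -(map_monic io) frob_norm_io //; exact: monic_prod_XsubC.
Qed.

Lemma size_frob_norm j x : x ^+ (p ^ j) = x -> size (frob_norm j x) = j.+1.
Proof.
by move=> xj; rewrite -(size_map_poly io) frob_norm_io // size_prod_XsubC size_frob_orbit.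
Qed.

(** Hence [lam] of the norm of x is the term of the character sum over the extension at x. *)
Lemma root_sum_frob_norm (f : {poly 'F_p}) j x : x ^+ (p ^ j) = x ->
  root_sum io f (frob_norm j x) = frob_trace p j (map_poly io f).[x].
Proof.
move=> xj; rewrite /root_sum.
have pe : perm_eq (closure_roots io (frob_norm j x)) (frob_orbit j x).
  by apply: prod_XsubC_eq; rewrite -closure_rootsE ?monic_frob_norm // frob_norm_io.
rewrite (perm_big _ pe) big_map -[j in iota 0 j]subn0 -/(index_iota 0 j) big_mkord.
by apply: eq_bigr => i _; rewrite -frob_io_horner.
Qed.

Lemma frob_norm_dvd j x D : x ^+ (p ^ j) = x -> D \is monic ->
  (frob_norm j x %| D) =
  all (fun z => (count_mem z (frob_orbit j x) <= count_mem z (closure_roots io D))%N)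
    (frob_orbit j x).
Proof.
by move=> xj mD; rewrite -(dvdp_map io) frob_norm_io // closure_rootsE // dvdp_prod_XsubC_count.
Qed.

Lemma count_closure_roots_frob D x : D \is monic ->
  count_mem (x ^+ p) (closure_roots io D) = count_mem x (closure_roots io D).
Proof.
move=> mD; set rs := closure_roots io D.
have : perm_eq rs [seq frob z | z <- rs].
  apply: prod_XsubC_eq; rewrite big_map -map_prod_XsubC -closure_rootsE //.
  apply/polyP => i; rewrite !coef_map /=.
  by have := io_frob io p_pr D`_i 1; rewrite expn1 => {1}<-.
move/permP/(_ (pred1 (x ^+ p))) => ->; rewrite count_map; apply: eq_count => z /=.
have /= inj := @frob_inj p K io p_pr 1; rewrite expn1 in inj.
by apply/eqP/eqP => [/inj|->].
Qed.

Lemma count_closure_roots_orbit D x i : D \is monic ->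
  count_mem (x ^+ (p ^ i)) (closure_roots io D) = count_mem x (closure_roots io D).
Proof.
move=> mD; elim: i => [|i IH]; first by rewrite expr1.
by rewrite expnSr exprM count_closure_roots_frob.
Qed.

(** Conjugates of a root are roots, so two of them coincide; injectivity of Frobenius then removes
    the initial segment. *)
Lemma closure_root_period D x : D \is monic -> x \in closure_roots io D ->
  exists2 j, (0 < j)%N & x ^+ (p ^ j) = x.
Proof.
move=> mD xD; set rs := closure_roots io D in xD.
have sub : {subset frob_orbit (size rs).+1 x <= rs}.
  move=> _ /mapP[i _ ->]; rewrite -has_pred1 has_count count_closure_roots_orbit //.
  by rewrite -has_count has_pred1.
have : ~~ uniq (frob_orbit (size rs).+1 x).
  by apply/negP => /uniq_leq_size/(_ sub); rewrite size_frob_orbit ltnn.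
case/(uniqPn 0) => i [k [ltik]]; rewrite size_frob_orbit => ltk.
rewrite !(nth_map 0%N) ?size_iota //; last exact: ltn_trans ltk.
rewrite !nth_iota //; last exact: ltn_trans ltk.
rewrite !add0n => e; exists (k - i)%N; first by rewrite subn_gt0.
apply: (frob_inj io p_pr (n:=i)) => /=.
by rewrite -exprM -expnD subnK ?(ltnW ltik).
Qed.

Lemma count_multiples (de m n : nat) : (0 < de)%N -> (de * m <= n)%N ->
  (\sum_(1 <= j < n.+1) ((de %| j) && (j %/ de <= m)) = m)%N.
Proof.
move=> de0 le_n; rewrite -big_mkcond /= -[RHS](size_iota 1) -(size_map (muln de)).
rewrite sum1_count -size_filter; apply: perm_size; apply: uniq_perm.
- by rewrite filter_uniq // iota_uniq.
- by rewrite map_inj_uniq ?iota_uniq // => a b /eqP; rewrite eqn_pmul2l // => /eqP.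
move=> j; rewrite mem_filter mem_index_iota; apply/idP/mapP.
  case/and3P => /andP[/dvdnP[e ->]]; rewrite mulnK // => em j1 _.
  by exists e; rewrite ?[(e * _)%N]mulnC // mem_iota; move: j1; rewrite muln_gt0 => /andP[-> _]; lia.
case=> e; rewrite mem_iota => /andP[e1 em] ->.
rewrite dvdn_mulr // mulKn // muln_gt0 de0 e1 /= ltnS.
have em' : (e <= m)%N by lia.
by rewrite em' /=; apply: leq_trans le_n; rewrite leq_mul2l em' orbT.
Qed.

(* Writing [de] for the degree of [x] over the prime field, [frob_norm j x] is
   the [j / de]-th power of the minimal polynomial of [x]. *)
Lemma frob_norm_count_root D n x :
  D \is monic -> size D = n.+1 -> x \in closure_roots io D ->
  (\sum_(1 <= j < n.+1) ((x ^+ (p ^ j) == x) && (frob_norm j x %| D)%R) =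
   count_mem x (closure_roots io D))%N.
Proof.
move=> mD szD xD; set m := count_mem x _.
have [j0 j0_gt0 xj0] := closure_root_period mD xD.
have ex : exists j, (0 < j)%N && (x ^+ (p ^ j) == x) by exists j0; rewrite j0_gt0 xj0 eqxx.
case: (ex_minnP ex) => de /andP[de0 /eqP xde] de_min.
have xmul e : x ^+ (p ^ (de * e)) = x.
  elim: e => [|e IH]; first by rewrite muln0 expr1.
  by rewrite mulnS expnD exprM xde.
have xper j : (x ^+ (p ^ j) == x) = (de %| j)%N.
  apply/idP/dvdnP => [|[e ->]]; last by rewrite mulnC xmul.
  rewrite {1}(divn_eq j de) mulnC expnD exprM xmul => xr; exists (j %/ de)%N.
  have [r0|r0] := posnP (j %% de)%N; first by rewrite {1}(divn_eq j de) r0 addn0.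
  have := de_min (j %% de)%N; rewrite r0 xr => /(_ isT).
  by rewrite leqNgt ltn_mod de0.
have orb_uniq : uniq (frob_orbit de x).
  rewrite map_inj_in_uniq ?iota_uniq // => i k; rewrite !mem_iota !add0n /= => id kd.
  wlog lik : i k id kd / (i <= k)%N => [hw|] e.
    by have [/hw|/ltnW /hw] := leqP i k => -> //.
  apply/eqP; rewrite eqn_leq lik leqNgt; apply/negP => ltik.
  have : x ^+ (p ^ (k - i)) = x.
    apply: (frob_inj io p_pr (n:=i)) => /=.
    by rewrite -exprM -expnD subnK.
  move/eqP; rewrite xper => /dvdn_leq; rewrite subn_gt0 ltik => /(_ isT); lia.
have orb_count z e : count_mem z (frob_orbit (de * e) x) = (e * count_mem z (frob_orbit de x))%N.
  elim: e => [|e IH]; first by rewrite muln0.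
  rewrite mulnSr /frob_orbit iotaD map_cat count_cat IH mulSnr; congr (_ + _)%N.
  rewrite add0n -[X in iota X de]addn0 iotaDl -map_comp; congr (count _ _).
  by apply: eq_map => i /=; rewrite expnD exprM xmul.
have orb_dvd e : (frob_norm (de * e) x %| D) = (e <= m)%N.
  rewrite frob_norm_dvd //; apply/allP/idP => [H|em].
    case: e H => // e /(_ x).
    have x0 d : (0 < d)%N -> x \in frob_orbit d x.
      by move=> d0; apply/mapP; exists 0%N; rewrite ?expr1 // mem_iota.
    rewrite x0 ?muln_gt0 ?de0 // orb_count (count_uniq_mem _ orb_uniq) x0 // muln1.
    by apply.
  move=> z /mapP[i _ ->]; rewrite orb_count count_closure_roots_orbit // -/m.
  by rewrite (count_uniq_mem _ orb_uniq); case: (_ \in _); rewrite ?muln1 ?muln0.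
have dem : (de * m <= n)%N.
  have := orb_dvd m; rewrite leqnn => /(dvdp_leq (monic_neq0 mD)).
  by rewrite size_frob_norm // szD.
rewrite -[RHS](count_multiples de0 dem); apply: eq_bigr => j _.
rewrite xper; case: (boolP (de %| j)%N) => //= /dvdnP[e ->].
by rewrite mulnC orb_dvd mulKn.
Qed.

(** The polynomial analogue of log n being the sum of the von Mangoldt function over the divisors of
    n: every root of D contributes its multiplicity. *)
Lemma frob_norm_count D n : D \is monic -> size D = n.+1 ->
  (\sum_(1 <= j < n.+1) count (fun x => (frob_norm j x %| D)%R) (frob_points j) = n)%N.
Proof.
move=> mD szD; set rs := closure_roots io D.
have -> : (\sum_(1 <= j < n.+1) count (fun x => (frob_norm j x %| D)%R) (frob_points j) =
    \sum_(1 <= j < n.+1) \sum_(x <- undup rs) ((x ^+ (p ^ j) == x) && (frob_norm j x %| D)%R))%N.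
  rewrite !big_nat; apply: eq_bigr => j /andP[j1 _].
  rewrite -big_mkcond /= sum1_count -!size_filter; apply: perm_size; apply: uniq_perm.
  - by rewrite filter_uniq // (frob_points_uniq io).
  - by rewrite filter_uniq // undup_uniq.
  move=> x; rewrite !mem_filter mem_frob_points // mem_undup andbC.
  case: eqP => //= xj; case dv: (_ %| _) => //=; symmetry.
  rewrite -(root_prod_XsubC rs) -closure_rootsE //.
  apply: (root_dvdp (p := map_poly io (frob_norm j x))); first by rewrite dvdp_map.
  rewrite frob_norm_io // root_prod_XsubC; apply/mapP; exists 0%N; rewrite ?expr1 //.
  by rewrite mem_iota.
rewrite exchange_big /= big_seq (eq_bigr (fun x => count_mem x rs)) => [|x]; last first.
  by rewrite mem_undup => xrs; apply: frob_norm_count_root.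
rewrite -big_seq -[RHS](size_closure_roots io mD szD) -/rs -sum1_size.
rewrite -(big_undup_iterop_count _ rs); apply: eq_bigr => x _.
by elim: (count_mem x rs) => [|[|k] IH] //=; rewrite {1}IH.
Qed.

End Norms.

(** * The logarithmic derivative of the L-function *)

Section Recursion.
Variables (p : nat) (K : closedFieldType) (io : {rmorphism 'F_p -> K}).
Hypothesis p_pr : prime p.
Variables (f : {poly 'F_p}) (C : numClosedFieldType) (psi : 'F_p -> C).
Hypotheses (psiD : forall a b, psi (a + b) = psi a * psi b) (psi0 : psi 0 = 1).

Definition ext_sum n : C :=
  \sum_(x <- frob_points p K n) psi (unio io (frob_trace p n (map_poly io f).[x])).

Local Notation lam := (lam io f psi).
Local Notation Lcoef := (Lcoef io f psi).

Lemma sum_lam_multiples (D : {poly 'F_p}) j n :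
  D \is monic -> size D = j.+1 -> (j <= n)%N ->
  \sum_(w : 'rV['F_p]_(n - j)) lam (D * monic_poly w) =
  \sum_(v : 'rV['F_p]_n | D %| monic_poly v) lam (monic_poly v).
Proof.
move=> mD szD jn.
have szDw (w : 'rV['F_p]_(n - j)) : size (D * monic_poly w) = n.+1.
  by rewrite size_Mmonic ?monic_neq0 ?monic_monic_poly // szD size_monic_poly addSn addnS /= subnKC.
have mDw (w : 'rV['F_p]_(n - j)) : D * monic_poly w \is monic.
  by rewrite rpredM ?monic_monic_poly.
have poly_of m (g : {poly 'F_p}) : g \is monic -> size g = m.+1 ->
    monic_poly (poly_rV (g - 'X^m) : 'rV_m) = g.
  by move=> mg sg; have [v ->] := monic_polyP mg sg; rewrite /monic_poly addrAC subrr add0r rVpolyK.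
pose h (w : 'rV['F_p]_(n - j)) : 'rV['F_p]_n := poly_rV (D * monic_poly w - 'X^n).
pose h' (v : 'rV['F_p]_n) : 'rV['F_p]_(n - j) := poly_rV (monic_poly v %/ D - 'X^(n - j)).
have hE w : monic_poly (h w) = D * monic_poly w by rewrite poly_of.
have hK w : h' (h w) = w.
  by apply: monic_poly_inj; rewrite /h' hE mulKp ?monic_neq0 // /monic_poly addrAC subrr add0r rVpolyK.
have h'K v : D %| monic_poly v -> h (h' v) = v.
  move=> Dv; have e : monic_poly v = D * (monic_poly v %/ D) by rewrite mulrC divpK.
  have mq : monic_poly v %/ D \is monic.
    by have := monic_monic_poly v; rewrite {1}e monicMl.
  have sq : size (monic_poly v %/ D) = (n - j).+1.
    by rewrite size_divp ?monic_neq0 // size_monic_poly szD /=; lia.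
  by apply: monic_poly_inj; rewrite hE /h' poly_of // -e.
rewrite [RHS](reindex_onto h h') //=; apply: eq_big => [w|w _]; last by rewrite hE.
by rewrite hE hK dvdp_mulr ?eqxx.
Qed.

(** Coefficientwise this is t L'(t) = L(t) S(t), with S the generating series of the sums over the
    extensions. Instead of an Euler product, the pairs (x, D) such that the norm of x divides D are
    counted, each D of degree n occurring n times. *)
Lemma Lcoef_recursion n :
  n%:R * Lcoef n = \sum_(1 <= j < n.+1) ext_sum j * Lcoef (n - j).
Proof.
pose Nm := frob_norm io.
have term j : (0 < j)%N -> (j <= n)%N -> ext_sum j * Lcoef (n - j) =
    \sum_(v : 'rV['F_p]_n) \sum_(x <- frob_points p K j | Nm j x %| monic_poly v) lam (monic_poly v).
  move=> j0 jn; rewrite /ext_sum mulr_suml big_seq.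
  under eq_bigr => x _ do rewrite mulr_sumr.
  rewrite (eq_bigr (fun x => \sum_(v : 'rV['F_p]_n | Nm j x %| monic_poly v) lam (monic_poly v))).
    rewrite -big_seq; under eq_bigr => x _ do rewrite big_mkcond.
    by rewrite exchange_big; apply: eq_bigr => v _; rewrite -big_mkcond.
  move=> x; rewrite mem_frob_points // => /eqP xj.
  have mN := monic_frob_norm io p_pr xj; have sN := size_frob_norm io p_pr xj.
  rewrite -(sum_lam_multiples mN sN jn).
  apply: eq_bigr => w _; rewrite lamM ?monic_frob_norm ?monic_monic_poly //.
  by rewrite /lam root_sum_frob_norm.
rewrite big_nat; under eq_bigr => j /andP[j1 jn] do rewrite term //.
rewrite -big_nat exchange_big /Lcoef mulr_sumr; apply: eq_bigr => v _ /=.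
have cnt := frob_norm_count io p_pr (monic_monic_poly v) (size_monic_poly v).
rewrite -{1}cnt natr_sum mulr_suml; apply: eq_bigr => j _.
by rewrite big_const_seq iter_addr_0 mulr_natl.
Qed.

(** L is a polynomial of degree less than d, so it has d - 1 inverse roots, some possibly zero.
    Newton's identities and [Lcoef_recursion] are then the same recursion up to sign. *)
Lemma ext_sum_psum d :
  (exists a, psi a != 1) -> size f = d.+1 -> (0 < d < p)%N ->
  exists2 om : seq C, size om = d.-1 & forall k, (0 < k)%N -> ext_sum k = - psum om k.
Proof.
move=> psiN szf dp; have d0 : (0 < d)%N by case/andP: dp.
have Lbig n : (d <= n)%N -> Lcoef n = 0 by exact: Lcoef_eq0.
(* The coefficients are reversed so that the roots of Q are the inverse roots of L; Q is monic as
   [Lcoef 0] is 1. *)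
pose Q : {poly C} := \poly_(i < d) Lcoef (d.-1 - i).
have szQ : size Q = d.
  by rewrite size_poly_eq // subnn Lcoef0 // oner_neq0.
have lcQ : lead_coef Q = 1.
  by rewrite lead_coefE szQ coef_poly prednK // leqnn subnn Lcoef0.
have [om] := closed_field_poly_normal Q; rewrite lcQ scale1r => Qom.
have szom : size om = d.-1.
  by have := szQ; rewrite Qom size_prod_XsubC => <-.
exists om => //.
have LE k : Lcoef k = (rev_prod om)`_k.
  have [kd|dk] := leqP k d.-1; last first.
    by rewrite rev_prod_big ?szom // Lbig // -(prednK d0).
  rewrite -coef_prod_XsubC_rev szom // -Qom coef_poly ifT; last by lia.
  by rewrite subKn.
elim/ltn_ind => -[|k] // IH _.
have := Lcoef_recursion k.+1; rewrite big_add1 big_nat_recr //= subnn Lcoef0 // mulr1 big_mkord.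
have := newton_identity om k.+1.
rewrite big_ord_recl /= coef0_rev_prod mul1r subn0 -LE => N R.
have E : \sum_(i < k) ext_sum i.+1 * Lcoef (k.+1 - i.+1) =
         - \sum_(i < k) (rev_prod om)`_(bump 0 i) * psum om (k.+1 - bump 0 i).
  rewrite (reindex_inj rev_ord_inj) -sumrN; apply: eq_bigr => i _ /=.
  have ik := ltn_ord i; rewrite /bump /= add1n.
  rewrite IH; [|lia..].
  rewrite LE mulrC mulrN (_ : (k.+1 - (k - i.+1).+1)%N = i.+1); last by lia.
  by rewrite (_ : (k - i.+1).+1 = (k.+1 - i.+1)%N) //; lia.
move: R; rewrite E; set S := \sum_(i < k) _ in N * => R.
have -> : ext_sum k.+1 = k.+1%:R * Lcoef k.+1 + S by rewrite R addrAC addNr add0r.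
have -> : psum om k.+1 = - (k.+1%:R * Lcoef k.+1) - S by rewrite -N addrK.
by ring.
Qed.

End Recursion.

(** * Bounded power sums *)

Section BoundedPowerSums.
Variable C : numClosedFieldType.
Hypothesis C_archi : forall x : C, exists n : nat, `|x| <= n%:R.

Lemma bernoulli_ineq (t : C) k : 0 <= t -> 1 + k%:R * t <= (1 + t) ^+ k.
Proof.
move=> t0; elim: k => [|k IH]; first by rewrite mul0r addr0 expr0.
rewrite exprS; apply: le_trans (ler_wpM2l _ IH); last by rewrite addr_ge0.
have -> : (1 + t) * (1 + k%:R * t) = 1 + k.+1%:R * t + k%:R * t ^+ 2.
  by rewrite -addn1 natrD; ring.
by rewrite lerDl mulr_ge0 // exprn_ge0.
Qed.

(** By Bernoulli's inequality the powers of x > 1 grow at least linearly, and the archimedean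
    property makes this unbounded. *)
Lemma bounded_exprn (x B : C) k0 : 0 <= x ->
  (forall k, (k0 <= k)%N -> x ^+ k <= B) -> x <= 1.
Proof.
move=> x0 xB; rewrite real_leNgt ?ger0_real //; apply/negP => x1.
have t0 : 0 < x - 1 by rewrite subr_gt0.
have [n nP] := C_archi (B / (x - 1)).
have B0 : 0 <= B by apply: le_trans (xB k0 (leqnn _)); rewrite exprn_ge0.
have Bt : 0 <= B / (x - 1) by rewrite divr_ge0 // ltW.
rewrite (ger0_norm Bt) ler_pdivrMr // in nP.
pose k := (k0 + n)%N.
have := bernoulli_ineq k (ltW t0); rewrite [1 + (x - 1)]addrC subrK => H.
have lt : n%:R * (x - 1) < 1 + k%:R * (x - 1).
  rewrite -subr_gt0.
  have -> : 1 + k%:R * (x - 1) - n%:R * (x - 1) = 1 + k0%:R * (x - 1) by rewrite /k natrD; ring.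
  by apply: ltr_wpDr => //; rewrite mulr_ge0 // ltW.
by have := le_trans H (le_trans (xB k (leq_addr _ _)) nP); rewrite (lt_geF lt).
Qed.

(* The linear recurrence operator killing all the other exponentials isolates
   a single one, so a bounded power sum has bounded terms. *)
Lemma bounded_psum_norm (zs : seq C) (B : C) k0 :
  (forall k, (k0 <= k)%N -> `|psum zs k| <= B) -> forall z, z \in zs -> `|z| <= 1.
Proof.
move=> HB z zzs.
pose q : {poly C} := \prod_(y <- [seq y <- undup zs | y != z]) ('X - y%:P).
have qz : q.[z] != 0.
  by rewrite -/(root q z) root_prod_XsubC mem_filter eqxx.
have q0 y : y \in zs -> y != z -> q.[y] = 0.
  by move=> yzs yz; apply/rootP; rewrite root_prod_XsubC mem_filter yz mem_undup.
have m0 : (0 < count_mem z zs)%N by rewrite -has_count has_pred1.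
have iso k : \sum_(j < size q) q`_j * psum zs (k + j) = (count_mem z zs)%:R * (z ^+ k * q.[z]).
  under eq_bigr => j _ do rewrite /psum mulr_sumr.
  rewrite exchange_big /= (eq_big_seq (fun y => z ^+ k * q.[z] *+ (y == z))) => [|y yzs].
    elim: (zs) => [|y s IHs] /=; first by rewrite big_nil mul0r.
    by rewrite big_cons IHs natrD mulrDl [(_ == _)%:R * _]mulr_natl.
  have -> : \sum_(j < size q) q`_j * y ^+ (k + j) = y ^+ k * q.[y].
    by rewrite horner_coef mulr_sumr; apply: eq_bigr => j _; rewrite exprD mulrCA.
  have [->|yz] := eqVneq y z; first by rewrite mulr1n.
  by rewrite q0 // mulr0 mulr0n.
apply: (@bounded_exprn _ ((\sum_(j < size q) `|q`_j| * B) / `|q.[z]|) k0) => // k kk0.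
rewrite ler_pdivlMr ?normr_gt0 // -normrX -normrM.
apply: le_trans (_ : `|\sum_(j < size q) q`_j * psum zs (k + j)| <= _).
  rewrite iso [X in _ <= X]normrM normr_nat ler_peMl // ?normr_ge0 // ler1n; exact: m0.
apply: le_trans (ler_norm_sum _ _ _) _; apply: ler_sum => j _.
by rewrite normrM ler_wpM2l // HB // (leq_trans kk0) ?leq_addr.
Qed.

End BoundedPowerSums.

(** * From point counts to Weil's bound *)

Section Weil.
Variables (p : nat) (C : numClosedFieldType) (psi : 'F_p -> C).
Hypothesis C_archi : forall x : C, exists n : nat, `|x| <= n%:R.
Hypothesis p_pr : prime p.
Hypotheses (psiD : forall a b, psi (a + b) = psi a * psi b) (psi0 : psi 0 = 1).
Hypotheses (psi_norm : forall a, `|psi a| = 1) (psi_neq1 : exists a, psi a != 1).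
Variables (f : {poly 'F_p}) (d : nat).
Hypotheses (szf : size f = d.+1) (d_gt0 : (0 < d)%N) (d_ltp : (d < p)%N).

Lemma add_char_sum0 : \sum_a psi a = 0.
Proof using psiD psi_neq1.
have [b psib] := psi_neq1.
have : \sum_a psi a = (\sum_a psi a) * psi b.
  rewrite {1}(reindex_inj (addIr b)) /= mulr_suml; apply: eq_bigr => a _; exact: psiD.
move/eqP; rewrite -{1}[\sum_a _]mulr1 -subr_eq0 -mulrBr mulf_eq0 => /orP[/eqP //|].
by rewrite subr_eq0 eq_sym (negPf psib).
Qed.

Section Closure.
Variables (K : closedFieldType) (io : {rmorphism 'F_p -> K}).

(** Adding to f a constant e of trace -a moves the fibre over a to the fibre over 0. There the
    telescoping trace relation shows that the solutions y of y^p - y = f(x) + e are rational, as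
    Stepanov's bound requires. *)
Lemma trace_fiber_bound k a : (p ^ 2 * d ^ 2 + 2 * p * d < p ^ k.+1)%N ->
  (p * count (fun x => unio io (frob_trace p (2 * k.+1) (map_poly io f).[x]) == a)
     (frob_points p K (2 * k.+1)) <= p ^ k.+1 * p ^ k.+1 + 2 * p * d * p ^ k.+1)%N.
Proof.
move=> Pbig; set n := (2 * k.+1)%N.
have p_gt1 := prime_gt1 p_pr.
have PP : (p ^ k.+1 * p ^ k.+1 = p ^ n)%N by rewrite -expnD addnn -mul2n.
have [e eP] : exists e, frob_trace p n e = - io a.
  pose q : {poly K} := \sum_(i < n) 'X^(p ^ i) + (io a)%:P.
  have /closed_rootP[e] : size q != 1.
    have : q`_1 = 1.
      rewrite coefD coefC addr0 coef_sum (bigD1 ord0) //= coefXn eqxx big1 ?addr0 // => i i0.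
      rewrite coefXn; case: eqP => // /esym /eqP; rewrite -[X in _ == X](expn0 p) eqn_exp2l //.
      by rewrite -val_eqE /= in i0; rewrite (negPf i0).
    move=> q1; apply/eqP => sq; have /eqP := oner_neq0 K; apply.
    by rewrite -q1 nth_default ?sq.
  rewrite /root hornerD hornerC horner_sum addr_eq0 => /eqP h; exists e.
  by rewrite -h; apply: eq_bigr => i _; rewrite hornerXn.
rewrite -size_filter; set zs := filter _ _.
apply: (@stepanov_bound K p d k (map_poly io f + e%:P)) => //.
- exact: pchar_closure io p_pr.
- by rewrite size_polyDl size_map_poly szf // (leq_ltn_trans (size_polyC_leq1 _)).
- by rewrite prime_coprime // gtnNdvd.
- by rewrite filter_uniq // (frob_points_uniq io).
move=> x; rewrite mem_filter mem_frob_points // => /andP[/eqP tx /eqP xn].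
rewrite PP; split => //.
have trx : frob_trace p n (map_poly io f).[x] = io a.
  by rewrite -tx unio_trace // frob_io_horner // xn.
have /closed_rootP[y] : size ('X^p - 'X - ((map_poly io f).[x] + e)%:P) != 1.
  rewrite -addrA size_polyDl size_polyXn; first by case: (p) p_gt1.
  rewrite ltnS -opprD size_polyN; apply: leq_trans (size_polyD _ _) _.
  by rewrite geq_max size_polyX p_gt1 (leq_trans (size_polyC_leq1 _)) // ltnW.
rewrite /root !hornerE subr_eq0 => /eqP yF; exists y => //.
apply/eqP; rewrite -subr_eq0 -(frob_trace_sub p n y) -(frob_traceN io) // -(frob_traceD io) //.
by rewrite yF (frob_traceD io) // trx eP subrr.
Qed.

(** The slacks P^2 + 2 p d P - p N(a) are nonnegative with total 2 p^2 d P, because the N(a) sum to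
    P^2. As [psi] sums to 0, replacing p N(a) by minus the slack does not change the character
    sum. *)
Lemma ext_sum_bound k : (p ^ 2 * d ^ 2 + 2 * p * d < p ^ k.+1)%N ->
  `|ext_sum io f psi (2 * k.+1)| <= (2 * p * d * p ^ k.+1)%:R.
Proof.
move=> Pbig; set n := (2 * k.+1)%N; set P := (p ^ k.+1)%N.
pose g x := unio io (frob_trace p n (map_poly io f).[x]).
pose N a := count (fun x => g x == a) (frob_points p K n).
have extE : ext_sum io f psi n = \sum_a (N a)%:R * psi a.
  rewrite /ext_sum (partition_big g xpredT) //=; apply: eq_bigr => a _.
  rewrite (eq_bigr (fun=> psi a)) => [|x /eqP <- //].
  by rewrite big_const_seq iter_addr_0 mulr_natl.
have sumN : (\sum_a N a = P * P)%N.
  rewrite /P -expnD addnn -mul2n -/n -(size_frob_points K p_pr (n := n)) //.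
  by rewrite -sum1_size (partition_big g xpredT) //=; apply: eq_bigr => a _; rewrite sum1_count.
have NP a : (p * N a <= P * P + 2 * p * d * P)%N by apply: trace_fiber_bound.
have p0 : (0 < p%:R :> C) by rewrite ltr0n prime_gt0.
rewrite -(ler_pM2l p0) -{1}(ger0_norm (ltW p0)) -normrM extE.
have -> : p%:R * (\sum_a (N a)%:R * psi a) =
    - \sum_a ((P * P + 2 * p * d * P) - p * N a)%N%:R * psi a.
  have -> : \sum_a (P * P + 2 * p * d * P - p * N a)%N%:R * psi a =
     \sum_a ((P * P + 2 * p * d * P)%N%:R * psi a - p%:R * ((N a)%:R * psi a)).
    by apply: eq_bigr => a _; rewrite natrB // natrM; ring.
  by rewrite sumrB -!mulr_sumr add_char_sum0 mulr0 sub0r opprK.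
rewrite normrN; apply: le_trans (ler_norm_sum _ _ _) _.
under eq_bigr do rewrite normrM normr_nat psi_norm mulr1.
rewrite -natr_sum -natrM ler_nat sumnB; last by move=> a _; apply: NP.
rewrite -big_distrr /= sumN sum_nat_const card_Fp //.
by rewrite mulnDr addKn.
Qed.

Lemma ext_sum1 : ext_sum io f psi 1 = \sum_(x : 'F_p) psi f.[x].
Proof.
rewrite /ext_sum; have pe : perm_eq (frob_points p K 1) [seq io a | a : 'F_p].
  have ui : uniq [seq io a | a : 'F_p] by rewrite map_inj_uniq ?enum_uniq //; exact: fmorph_inj.
  rewrite perm_sym; apply: uniq_perm => //; first exact: (frob_points_uniq io).
  have sub : {subset [seq io a | a : 'F_p] <= frob_points p K 1}.
    by move=> _ /mapP[a _ ->]; rewrite mem_frob_points // io_frob.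
  have sz : (size (frob_points p K 1) <= size [seq io a | a : 'F_p])%N.
    by rewrite (size_frob_points K p_pr) // size_map -cardE card_Fp // expn1.
  by case: (uniq_min_size ui sub sz).
rewrite (perm_big _ pe) big_map big_enum; apply: eq_bigr => x _.
by rewrite /frob_trace big_ord1 expr1 horner_map ioK.
Qed.

(** The inverse roots do not depend on the extension. Bounds O(p^k) for their power sums of exponent
    2 k, whatever the implied constant, give each of them modulus at most p^(1/2), and this is then
    used in degree 1. *)
Lemma weil_bound_closure : `|\sum_(x : 'F_p) psi f.[x]| <= (d.-1)%:R * sqrtC p%:R.
Proof.
have [|om szom omP] := ext_sum_psum io p_pr psiD psi0 psi_neq1 szf.
  by rewrite d_gt0.
have p0 : (0 < p%:R :> C) by rewrite ltr0n prime_gt0.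
have om_bound w : w \in om -> `|w| <= sqrtC p%:R.
  move=> wom.
  have : `|w ^+ 2 / p%:R| <= 1.
    (* The starting exponent is chosen so that p^k > k gives the size condition of
       [ext_sum_bound]. *)
    apply: (@bounded_psum_norm C C_archi [seq z ^+ 2 / p%:R | z <- om] (2 * p * d)%:R
      (p ^ 2 * d ^ 2 + 2 * p * d).+1); last by apply: map_f.
    case=> [|k] //; rewrite ltnS => kb.
    have -> : psum [seq z ^+ 2 / p%:R | z <- om] k.+1 = psum om (2 * k.+1) / (p ^ k.+1)%:R.
      rewrite /psum big_map mulr_suml; apply: eq_bigr => z _.
      by rewrite expr_div_n -exprM natrX.
    rewrite normrM normfV normr_nat -[psum _ _]opprK -omP // normrN.
    rewrite ler_pdivrMr ?ltr0n ?expn_gt0 ?prime_gt0 // -natrM.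
    apply: ext_sum_bound; apply: leq_ltn_trans kb _.
    by apply: (leq_trans (ltn_expl _ (prime_gt1 p_pr))); rewrite leq_exp2l // prime_gt1.
  rewrite normrM normfV normr_nat ler_pdivrMr // mul1r normrX => w2.
  by rewrite -(ler_sqr _ _) ?nnegrE ?sqrtC_ge0 ?ler0n // sqrtCK.
rewrite -ext_sum1 omP // normrN /psum; under eq_bigr do rewrite expr1.
apply: le_trans (ler_norm_sum _ _ _) _.
rewrite big_seq; apply: le_trans (ler_sum _ (fun w wom => om_bound w wom)) _.
by rewrite -big_seq big_const_seq count_predT szom iter_addr_0 mulr_natl.
Qed.

End Closure.

Theorem weil_bound : `|\sum_(x : 'F_p) psi f.[x]| <= (d.-1)%:R * sqrtC p%:R.
Proof.
have [K [io _]] := countable_algebraic_closure 'F_p.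
exact: (weil_bound_closure io).
Qed.
End Weil.

(** * Duality and mean values over the units modulo M *)

(** Lagrange's identity; a general [numDomainType] allows its use over both R and R[i]. *)
Lemma cauchy_schwarz_pos (C : numDomainType) (I : Type) (r : seq I) (P : pred I) (x y : I -> C) :
  (forall i, 0 <= x i) -> (forall i, 0 <= y i) ->
  (\sum_(i <- r | P i) x i * y i) ^+ 2 <=
  (\sum_(i <- r | P i) x i ^+ 2) * (\sum_(i <- r | P i) y i ^+ 2).
Proof.
move=> x0 y0; rewrite -subr_ge0.
have H : 0 <= \sum_(i <- r | P i) \sum_(j <- r | P j) (x i * y j - x j * y i) ^+ 2.
  apply: sumr_ge0 => i _; apply: sumr_ge0 => j _.
  by apply: real_exprn_even_ge0 => //; rewrite rpredB // ger0_real // mulr_ge0.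
have E : \sum_(i <- r | P i) \sum_(j <- r | P j) (x i * y j - x j * y i) ^+ 2 =
  2%:R * ((\sum_(i <- r | P i) x i ^+ 2) * (\sum_(i <- r | P i) y i ^+ 2) -
         (\sum_(i <- r | P i) x i * y i) ^+ 2).
  have -> : \sum_(i <- r | P i) \sum_(j <- r | P j) (x i * y j - x j * y i) ^+ 2 =
    \sum_(i <- r | P i) \sum_(j <- r | P j) (x i ^+ 2 * y j ^+ 2) +
    \sum_(i <- r | P i) \sum_(j <- r | P j) (y i ^+ 2 * x j ^+ 2) -
    2%:R * \sum_(i <- r | P i) \sum_(j <- r | P j) (x i * y i * (x j * y j)).
    rewrite mulr_sumr -big_split -sumrB; apply: eq_bigr => i _ /=.
    rewrite mulr_sumr -big_split -sumrB; apply: eq_bigr => j _ /=; ring.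
  have H3 (u v : I -> C) : \sum_(i <- r | P i) \sum_(j <- r | P j) (u i * v j) =
      (\sum_(i <- r | P i) u i) * (\sum_(j <- r | P j) v j).
    by rewrite mulr_suml; apply: eq_bigr => i _; rewrite mulr_sumr.
  rewrite (H3 (fun i => x i ^+ 2) (fun i => y i ^+ 2)) (H3 (fun i => y i ^+ 2) (fun i => x i ^+ 2)).
  by rewrite (H3 (fun i => x i * y i) (fun i => x i * y i)); ring.
by move: H; rewrite E pmulr_rge0.
Qed.

Section CauchySchwarz.
Variable C : numClosedFieldType.

Lemma cauchy_schwarz (I : Type) (r : seq I) (P : pred I) (a b : I -> C) :
  `|\sum_(i <- r | P i) a i * b i| ^+ 2 <=
  (\sum_(i <- r | P i) `|a i| ^+ 2) * (\sum_(i <- r | P i) `|b i| ^+ 2).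
Proof.
apply: le_trans (cauchy_schwarz_pos r P (x := fun i => `|a i|) (y := fun i => `|b i|) _ _) => //.
rewrite ler_sqr ?nnegrE ?normr_ge0 ?sumr_ge0 // => [|i _]; last by rewrite mulr_ge0.
apply: le_trans (ler_norm_sum _ _ _) _; apply: ler_sum => i _; by rewrite normrM.
Qed.

Lemma normD_sq (a b : C) : `|a + b| ^+ 2 <= 2%:R * `|a| ^+ 2 + 2%:R * `|b| ^+ 2.
Proof.
apply: le_trans (_ : (`|a| + `|b|) ^+ 2 <= _).
  by rewrite ler_sqr ?nnegrE ?addr_ge0 // ler_normD.
rewrite -subr_ge0.
have -> : 2%:R * `|a| ^+ 2 + 2%:R * `|b| ^+ 2 - (`|a| + `|b|) ^+ 2 = (`|a| - `|b|) ^+ 2 by ring.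
by apply: real_exprn_even_ge0 => //; rewrite rpredB // normr_real.
Qed.

End CauchySchwarz.

(** * Geometric sums and Fourier analysis modulo M *)

Section RootsOfUnity.
Variable C : numClosedFieldType.

Lemma norm_unity_root (z : C) n : (0 < n)%N -> z ^+ n = 1 -> `|z| = 1.
Proof.
move=> n0 zn; apply/eqP; rewrite -(pexpr_eq1 n0) // -normrX zn normr1 //.
Qed.

Lemma sum_unity_root (w : C) M : w ^+ M = 1 -> w != 1 -> \sum_(i < M) w ^+ i = 0.
Proof.
move=> wM w1; have := subrX1 w M; rewrite wM subrr => /esym/eqP.
by rewrite mulf_eq0 subr_eq0 (negPf w1) /= => /eqP.
Qed.

Lemma exp_conj_unity (z : C) M a b : (0 < M)%N -> z ^+ M = 1 ->
  (z ^+ a * (z ^+ b)^*) ^+ M = 1.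
Proof.
move=> M0 zM; rewrite exprMn -rmorphXn -!exprM ![(_ * M)%N]mulnC !exprM zM.
by rewrite !expr1n rmorph1 mulr1.
Qed.

Lemma mul_conj_unity (z : C) M : (0 < M)%N -> z ^+ M = 1 -> z * z^* = 1.
Proof. by move=> M0 zM; rewrite -normCK (norm_unity_root M0 zM) expr1n. Qed.

Lemma exp_conj_prim (z : C) M a b : (0 < M)%N -> M.-primitive_root z ->
  (z ^+ a * (z ^+ b)^* == 1) = (a == b %[mod M]).
Proof.
move=> M0 pz; have zM := prim_expr_order pz.
have zbM : (z ^+ b) ^+ M = 1 by rewrite -exprM mulnC exprM zM expr1n.
rewrite -(eq_prim_root_expr pz); have zz := mul_conj_unity M0 zbM.
apply/eqP/eqP => [e|->//].
by rewrite -[RHS]mul1r -e -mulrA [_^* * _]mulrC zz mulr1.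
Qed.

(** When eta^x differs from 1, full periods of the geometric sum vanish, so L can be replaced by its
    remainder r modulo the order of eta. After that the terms with eta^x = 1 may be restored, and
    orthogonality gives exactly M r. *)
Lemma exp_sum_l2 (eta : C) M L : (0 < M)%N -> eta ^+ M = 1 ->
  \sum_(x < M | eta ^+ x != 1) `|\sum_(a < L) eta ^+ (x * a)| ^+ 2 <= (M * L)%:R.
Proof.
move=> M0 etaM; have [m pm mM] := prim_order_exists M0 etaM.
have m0 := prim_order_gt0 pm; have etam := prim_expr_order pm.
pose r := (L %% m)%N.
apply: le_trans (_ : \sum_(x < M) `|\sum_(a < r) eta ^+ (x * a)| ^+ 2 <= _).
  rewrite [X in _ <= X](bigID (fun x : 'I_M => eta ^+ x != 1)) /=.
  rewrite ler_wpDr ?sumr_ge0 // => [i _|]; first by rewrite exprn_ge0.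
  rewrite le_eqVlt; apply/orP; left; apply/eqP; apply: eq_bigr => x ex; congr (`|_| ^+ 2).
  apply: (mulfI (_ : eta ^+ x - 1 != 0)); first by rewrite subr_eq0.
  under eq_bigr do rewrite exprM; rewrite -subrX1.
  under eq_bigr do rewrite exprM; rewrite -subrX1.
  by rewrite -!exprM {1}(divn_eq L m) -/r mulnDr exprD mulnA mulnC exprM etam expr1n mul1r.
have -> : \sum_(x < M) `|\sum_(a < r) eta ^+ (x * a)| ^+ 2 =
    \sum_(a < r) \sum_(b < r) \sum_(x < M) (eta ^+ a * (eta ^+ b)^*) ^+ x.
  under eq_bigr => x _.
    rewrite normCK rmorph_sum mulr_suml.
    under eq_bigr do rewrite mulr_sumr.
    over.
  rewrite exchange_big; apply: eq_bigr => a _; rewrite exchange_big; apply: eq_bigr => b _.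
  by apply: eq_bigr => x _; rewrite exprMn -rmorphXn -!exprM ![(x * _)%N]mulnC.
have -> : \sum_(a < r) \sum_(b < r) \sum_(x < M) (eta ^+ a * (eta ^+ b)^*) ^+ x =
    \sum_(a < r) M%:R.
  apply: eq_bigr => a _; rewrite (bigD1 a) //= [X in _ + X]big1 ?addr0.
    rewrite (mul_conj_unity M0); last by rewrite -exprM mulnC exprM etaM expr1n.
    by under eq_bigr do rewrite expr1n; rewrite sumr_const card_ord.
  move=> b ba; apply: sum_unity_root; first by rewrite exp_conj_unity.
  rewrite (exp_conj_prim _ _ m0 pm) !modn_small ?(ltn_trans (ltn_ord _)) ?ltn_mod //.
  by rewrite eq_sym.
rewrite sumr_const card_ord -mulrnA ler_nat leq_mul2l; apply/orP; right; exact: leq_mod.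
Qed.

End RootsOfUnity.

Section Variance.
Variables (C : numClosedFieldType) (M : nat) (zeta : C).
Hypotheses (M_gt0 : (0 < M)%N) (zeta_prim : M.-primitive_root zeta).
Variable f : nat -> C.
Hypotheses (f_per : forall n, f (n %% M) = f n) (f_le1 : forall n, `|f n| <= 1).

Definition fourier_coef (j : nat) : C :=
  M%:R^-1 * \sum_(r < M) f r * (zeta ^+ (j * r))^*.

Lemma natr_modulus_neq0 : M%:R != 0 :> C. Proof. by rewrite pnatr_eq0 -lt0n. Qed.

Lemma unity_orthogonality a b :
  \sum_(j < M) (zeta ^+ (j * a) * (zeta ^+ (j * b))^*) = if a == b %[mod M] then M%:R else 0.
Proof.
have E : \sum_(j < M) (zeta ^+ (j * a) * (zeta ^+ (j * b))^*) =
    \sum_(j < M) (zeta ^+ a * (zeta ^+ b)^*) ^+ j.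
  by apply: eq_bigr => j _; rewrite exprMn -rmorphXn -!exprM ![(j * _)%N]mulnC.
rewrite E; case: ifP => [|ab].
  rewrite -(exp_conj_prim _ _ M_gt0 zeta_prim) => /eqP ->.
  by under eq_bigr do rewrite expr1n; rewrite sumr_const card_ord.
apply: sum_unity_root; first by rewrite exp_conj_unity ?(prim_expr_order zeta_prim).
by rewrite (exp_conj_prim _ _ M_gt0 zeta_prim) ab.
Qed.

Lemma fourier_inversion n : f n = \sum_(j < M) fourier_coef j * zeta ^+ (j * n).
Proof.
have -> : \sum_(j < M) fourier_coef j * zeta ^+ (j * n) =
    M%:R^-1 * \sum_(r < M) f r * \sum_(j < M) (zeta ^+ (j * n) * (zeta ^+ (j * r))^*).
  rewrite mulr_sumr; under [RHS]eq_bigr do rewrite !mulr_sumr.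
  rewrite exchange_big; apply: eq_bigr => j _; rewrite /fourier_coef -mulrA mulr_suml mulr_sumr.
  by apply: eq_bigr => r _; ring.
have nM : (n %% M < M)%N by rewrite ltn_mod.
rewrite (bigD1 (Ordinal nM)) //= [X in _ + X]big1 ?addr0 => [|r rn].
  by rewrite unity_orthogonality modn_mod eqxx f_per mulrCA mulVf ?natr_modulus_neq0 ?mulr1.
rewrite unity_orthogonality ifF ?mulr0 //.
by rewrite (modn_small (ltn_ord r)) eq_sym; apply/negP => /eqP rE; case/eqP: rn; apply: val_inj.
Qed.

Lemma fourier_parseval : \sum_(j < M) `|fourier_coef j| ^+ 2 <= 1.
Proof.
have -> : \sum_(j < M) `|fourier_coef j| ^+ 2 = M%:R^-1 * \sum_(r < M) `|f r| ^+ 2.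
  have -> : \sum_(r < M) `|f r| ^+ 2 =
      \sum_(r < M) \sum_(j < M) (fourier_coef j * (zeta ^+ (j * r)) * (f r)^*).
    by apply: eq_bigr => r _; rewrite normCK {1}fourier_inversion mulr_suml.
  rewrite exchange_big mulr_sumr; apply: eq_bigr => j _ /=.
  rewrite normCK {2}/fourier_coef rmorphM fmorphV rmorph_nat rmorph_sum mulrCA; congr (_ * _).
  rewrite mulr_sumr; apply: eq_bigr => r _; rewrite rmorphM /= conjCK; ring.
rewrite ler_pdivrMl ?ltr0n // mulr1.
apply: le_trans (_ : \sum_(r < M) 1 <= _); last by rewrite sumr_const card_ord.
by apply: ler_sum => r _; rewrite exprn_ile1.
Qed.

(** Frequency 0 gives the mean. For the others the sum over the box factors as the square of a
    geometric sum K_j(x), and Cauchy-Schwarz over j separates |c_j K_j(x)|^2 from |K_j(x)|^2. As x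
    is coprime to M, j x is nonzero modulo M, so [exp_sum_l2] applies both in j and in x; Parseval
    sums the |c_j|^2. *)
Lemma variance_bound L y0 :
  \sum_(x < M | coprime x M) `|\sum_(a < L) \sum_(b < L) f (x * (a + b + y0))| ^+ 2 <=
  2%:R * (L ^ 4)%:R * `|\sum_(r < M) f r| ^+ 2 / M%:R + 2%:R * ((M * L) ^ 2)%:R.
Proof.
pose Kx j x := \sum_(a < L) zeta ^+ (j * x * a).
have zM := prim_expr_order zeta_prim.
have zXM n : (zeta ^+ n) ^+ M = 1 by rewrite -exprM mulnC exprM zM expr1n.
pose j0 : 'I_M := Ordinal M_gt0.
have sumE x : \sum_(a < L) \sum_(b < L) f (x * (a + b + y0)) =
    \sum_(j < M) fourier_coef j * zeta ^+ (j * x * y0) * Kx j x * Kx j x.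
  under eq_bigr => a _ do under eq_bigr => b _ do rewrite fourier_inversion.
  under eq_bigr => a _ do rewrite exchange_big.
  rewrite exchange_big; apply: eq_bigr => j _ /=.
  rewrite -mulrA {1}/Kx mulr_suml mulr_sumr; apply: eq_bigr => a _.
  rewrite /Kx !mulr_sumr; apply: eq_bigr => b _.
  by rewrite !mulnA !mulnDr !exprD; ring.
pose T x := \sum_(j < M | j != j0) fourier_coef j * zeta ^+ (j * x * y0) * Kx j x * Kx j x.
have mainE x : fourier_coef 0 * zeta ^+ (0 * x * y0) * Kx 0%N x * Kx 0%N x =
    (L ^ 2)%:R * (M%:R^-1 * \sum_(r < M) f r).
  have -> : Kx 0%N x = L%:R.
    rewrite /Kx; under eq_bigr do rewrite !mul0n expr0.
    by rewrite sumr_const card_ord.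
  rewrite !mul0n expr0 mulr1 natrX -mulrA mulrC; congr (_ * _).
  rewrite /fourier_coef; congr (_ * _); apply: eq_bigr => r _.
  by rewrite mul0n expr0 rmorph1 mulr1.
have zj (j : 'I_M) : j != j0 -> zeta ^+ j != 1.
  by move=> jj; rewrite -(prim_order_dvd zeta_prim) gtnNdvd // lt0n.
have zxj (x : nat) (j : 'I_M) : coprime x M -> j != j0 -> zeta ^+ (x * j) != 1.
  move=> cx jj; rewrite -(prim_order_dvd zeta_prim) Gauss_dvdr 1?coprime_sym //.
  by rewrite gtnNdvd // lt0n.
have T_bound : \sum_(x < M | coprime x M) `|T x| ^+ 2 <= ((M * L) ^ 2)%:R.
  apply: le_trans (_ : \sum_(x < M | coprime x M)
      \sum_(j < M | j != j0) (M * L)%:R * (`|fourier_coef j| ^+ 2 * `|Kx j x| ^+ 2) <= _).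
    apply: ler_sum => x cx; apply: le_trans (cauchy_schwarz _ _ _ _) _.
    rewrite mulrC -mulr_sumr; apply: ler_pM.
    - by apply: sumr_ge0 => *; rewrite exprn_ge0.
    - by apply: sumr_ge0 => *; rewrite exprn_ge0.
    - apply: le_trans (exp_sum_l2 L M_gt0 (zXM x)).
      rewrite [X in X <= _](_ : _ = \sum_(j < M | j != j0) `|\sum_(a < L) (zeta ^+ x) ^+ (j * a)| ^+ 2).
        rewrite big_mkcond [X in _ <= X]big_mkcond; apply: ler_sum => j _.
        case: (boolP (j != j0)) => [jj|_]; last by case: ifP => // _; rewrite exprn_ge0.
        by rewrite -exprM zxj.
      apply: eq_bigr => j _; congr (`|_| ^+ 2); apply: eq_bigr => a _.
      by rewrite -exprM mulnCA mulnA.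
    apply: ler_sum => j _; rewrite !normrM (norm_unity_root M_gt0 (zXM _)) mulr1.
    by rewrite exprMn.
  rewrite (exchange_big_dep (fun j => j != j0)) //=.
  apply: le_trans (_ : \sum_(j < M | j != j0) ((M * L) ^ 2)%:R * `|fourier_coef j| ^+ 2 <= _).
    apply: ler_sum => j jj; under eq_bigr => x _ do rewrite mulrCA mulrC.
    rewrite -mulr_suml ler_wpM2r ?exprn_ge0 // natrX expr2 -mulr_sumr ler_wpM2l ?ler0n //.
    apply: le_trans (exp_sum_l2 L M_gt0 (zXM j)).
    rewrite big_mkcond [X in _ <= X]big_mkcond; apply: ler_sum => x _.
    case: (boolP (coprime x M)) => [cx|_]; last by case: ifP => // _; rewrite exprn_ge0.
    rewrite -exprM mulnC zxj //; rewrite le_eqVlt; apply/orP; left; apply/eqP.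
    by rewrite /= jj; congr (`|_| ^+ 2); apply: eq_bigr => a _; rewrite -exprM !mulnA.
  rewrite -mulr_sumr -[X in _ <= X]mulr1 ler_wpM2l ?ler0n //.
  apply: le_trans fourier_parseval.
  by rewrite [X in _ <= X](bigD1 j0) //= lerDr exprn_ge0.
apply: le_trans (_ : \sum_(x < M | coprime x M)
    (2%:R * `|(L ^ 2)%:R * (M%:R^-1 * \sum_(r < M) f r)| ^+ 2 + 2%:R * `|T x| ^+ 2) <= _).
  apply: ler_sum => x cx; rewrite sumE (bigD1 j0) //= mainE; exact: normD_sq.
rewrite big_split /= lerD //; last by rewrite -mulr_sumr ler_wpM2l.
set Z := `|_| ^+ 2.
apply: le_trans (_ : M%:R * (2%:R * Z) <= _).
  have -> : M%:R * (2%:R * Z) = \sum_(x < M) 2%:R * Z by rewrite sumr_const card_ord mulr_natl.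
  rewrite big_mkcond; apply: ler_sum => x _.
  by case: ifP => // _; rewrite mulr_ge0 // exprn_ge0.
rewrite /Z normrM normr_nat exprMn normrM normfV normr_nat exprMn.
rewrite le_eqVlt; apply/orP; left; apply/eqP.
by rewrite -natrX -expnM exprVn; field; apply: natr_modulus_neq0.
Qed.
End Variance.

Lemma closed_prim_root_exists (C : numClosedFieldType) M :
  (0 < M)%N -> exists z : C, M.-primitive_root z.
Proof.
move=> M0; have [rs] := closed_field_poly_normal ('X^M - 1 : {poly C}).
rewrite lead_coefXnsubC // scale1r => E.
have szr : size rs = M.
  by have := congr1 (fun q : {poly C} => size q) E; rewrite size_XnsubC // size_prod_XsubC => -[].
have /hasP[z _ pz] : has M.-primitive_root rs.
  apply: has_prim_root => //; last by rewrite szr.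
    by apply/allP => z zr; rewrite /root_of_unity E root_prod_XsubC.
  by rewrite -separable_prod_XsubC -E separable_Xn_sub_1 // pnatr_eq0 -lt0n.
by exists z.
Qed.

(** * Duality over the dilations *)

Section Duality.
Variables (C : numClosedFieldType) (M : nat) (phi : nat -> C).
Hypotheses (M_gt0 : (0 < M)%N) (phi_per : forall n, phi (n %% M)%N = phi n)
  (phi_norm : forall n, `|phi n| = 1).

Lemma units_dilation (F : nat -> C) u :
  (forall n, F (n %% M)%N = F n) -> coprime u M ->
  \sum_(x < M | coprime x M) F (u * x)%N = \sum_(x < M | coprime x M) F x.
Proof.
move=> Fper cu.
pose h (x : 'I_M) : 'I_M := Ordinal (ltn_pmod (u * x) M_gt0).
have h_inj : injective h.
  move=> x y /(congr1 val) /= /eqP e; apply: val_inj => /=.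
  wlog lexy : x y e / (x <= y)%N => [hw|].
    have [/hw|/ltnW /hw] := leqP x y; first exact.
    by rewrite eq_sym => /(_ e) ->.
  move: e; rewrite eq_sym eqn_mod_dvd ?leq_mul2l ?lexy ?orbT // -mulnBr Gauss_dvdr 1?coprime_sym //.
  by rewrite /dvdn modn_small; have := ltn_ord y; lia.
rewrite [RHS](reindex_inj h_inj) /=; apply: eq_big => [x|x _]; last by rewrite Fper.
by rewrite coprime_modl coprimeMl cu.
Qed.

(* The majorant is a convolution of intervals, so its Fourier coefficients are
   squares of geometric sums, whose mean is computed exactly: no logarithm is
   lost when completing the sum over [i]. *)
Lemma majorant_sum (F : nat -> C) N y0 : (forall n, 0 <= F n) ->
  N%:R * \sum_(i < N) F (i + N.-1 + y0)%N <=
  \sum_(a < 2 * N) \sum_(b < 2 * N) F (a + b + y0)%N.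
Proof.
move=> F0.
apply: le_trans (_ : \sum_(a < N) \sum_(b < 2 * N) F (a + b + y0)%N <= _); last first.
  rewrite -!(big_mkord xpredT (fun a => \sum_(b < 2 * N) F (a + b + y0)%N)).
  rewrite [X in _ <= X](big_cat_nat (n := N)) //=; last by lia.
  by rewrite lerDl sumr_ge0 // => a _; rewrite sumr_ge0.
have -> : N%:R * \sum_(i < N) F (i + N.-1 + y0)%N = \sum_(a < N) \sum_(i < N) F (i + N.-1 + y0)%N.
  by rewrite sumr_const card_ord mulr_natl.
apply: ler_sum => a _; have aN := ltn_ord a.
rewrite -!(big_mkord xpredT (fun b => F (a + b + y0)%N)) -(big_mkord xpredT (fun i => F (i + N.-1 + y0)%N)).
(* Each value i + N - 1 with i < N is a + b with b = i + k, for every a < N: it is represented at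
   least N times. *)
pose k := (N.-1 - a)%N.
rewrite [X in _ <= X](big_cat_nat (n := k)) //=; last by rewrite /k; lia.
rewrite [X in _ <= _ + X](big_cat_nat (n := (N + k)%N)) //=; [|rewrite /k; lia..].
have -> : \sum_(k <= b < N + k) F (a + b + y0)%N = \sum_(0 <= i < N) F (i + N.-1 + y0)%N.
  rewrite -{1}[k]add0n big_addn addnK !big_nat; apply: eq_bigr => i _; congr F; rewrite /k; lia.
by rewrite addrCA lerDl addr_ge0 // sumr_ge0.
Qed.

Variables (g : nat -> C) (c0 N : nat) (us : seq nat) (S : C).
Hypotheses (S_ge0 : 0 <= S) (g_le1 : forall n, `|g n| <= 1) (us_uniq : uniq us)
  (us_coprime : forall u, u \in us -> coprime u M)
  (S_bound : forall u u', u \in us -> u' \in us -> u != u' ->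
     `|\sum_(r < M) phi (u * r) * (phi (u' * r))^*| <= S).

(** Congruent to c0 - (N - 1) modulo M without subtracting naturals; it undoes the offset N - 1 in
    [majorant_sum]. *)
Let y0 := (c0 + M.-1 * N.-1)%N.
Let pairs := [seq (u, u') | u <- us, u' <- us].
Let G x (t : nat * nat) := \sum_(a < 2 * N) \sum_(b < 2 * N)
  phi (t.1 * (x * (a + b + y0))) * (phi (t.2 * (x * (a + b + y0))))^*.
(** The Hilbert-Schmidt norm of the off-diagonal part of the Gram matrix [G x]; it dominates the
    operator norm. *)
Let W x := sqrtC (\sum_(t <- pairs | t.1 != t.2) `|G x t| ^+ 2).
Let E x := \sum_(u <- us) `|\sum_(i < N) g i * phi (u * x * (c0 + i))| ^+ 2.

Lemma phi_mod a b : (a = b %[mod M])%N -> phi a = phi b.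
Proof. by move=> ab; rewrite -phi_per ab phi_per. Qed.

Lemma W_ge0 x : 0 <= W x.
Proof. by rewrite sqrtC_ge0 sumr_ge0 // => *; rewrite exprn_ge0. Qed.

Lemma E_ge0 x : 0 <= E x.
Proof. by rewrite sumr_ge0 // => *; rewrite exprn_ge0. Qed.

(** Writing E as the pairing of g with the dual sum H, Cauchy-Schwarz removes g and leaves a
    quadratic form in the vector c, whose squared length is E itself. Its diagonal entries are 4
    N^2, the size of the box, so E^2 <= E (4 N^2 + W), and E cancels. *)
Lemma dual_bound x : E x <= (4 * N ^ 2)%:R + W x.
Proof.
pose c u := \sum_(i < N) g i * phi (u * x * (c0 + i)).
pose H y := \sum_(u <- us) (c u)^* * phi (u * x * y).
have EH : E x = \sum_(i < N) g i * H (c0 + i)%N.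
  under [RHS]eq_bigr => i _ do rewrite mulr_sumr.
  rewrite exchange_big; apply: eq_bigr => u _ /=.
  rewrite -/(c u) normCK mulrC {2}/c mulr_sumr; apply: eq_bigr => i _; ring.
have E2 : E x ^+ 2 <= \sum_(a < 2 * N) \sum_(b < 2 * N) `|H (a + b + y0)%N| ^+ 2.
  rewrite -[E x]ger0_norm ?E_ge0 // {1}EH; apply: le_trans (cauchy_schwarz _ _ _ _) _.
  apply: le_trans (majorant_sum (F := fun n => `|H n| ^+ 2) N y0 _); last by move=> n; rewrite exprn_ge0.
  have -> : \sum_(i < N) `|H (c0 + i)%N| ^+ 2 = \sum_(i < N) `|H (i + N.-1 + y0)%N| ^+ 2.
    apply: eq_bigr => i _; congr (`|_| ^+ 2); apply: eq_bigr => u _; congr (_ * _).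
    apply: phi_mod; rewrite (_ : i + N.-1 + y0 = M * N.-1 + (c0 + i))%N.
      by rewrite (mulnDr _ (M * N.-1)) (mulnCA _ M) (mulnC M) modnMDl.
    by rewrite /y0; case: (M) M_gt0 => // m _ /=; rewrite mulSn; lia.
  rewrite ler_wpM2r ?sumr_ge0 // => [*|]; first by rewrite exprn_ge0.
  apply: le_trans (_ : \sum_(i < N) 1 <= _); last by rewrite sumr_const card_ord.
  by apply: ler_sum => i _; rewrite exprn_ile1.
have HG : \sum_(a < 2 * N) \sum_(b < 2 * N) `|H (a + b + y0)%N| ^+ 2 =
    \sum_(t <- pairs) (c t.1)^* * c t.2 * G x t.
  rewrite big_allpairs.
  under [RHS]eq_bigr => u _ do under eq_bigr => u' _ do rewrite /= /G mulr_sumr.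
  under [RHS]eq_bigr => u _ do rewrite exchange_big.
  rewrite [RHS]exchange_big; apply: eq_bigr => a _ /=.
  under [RHS]eq_bigr => u _ do under eq_bigr => u' _ do rewrite mulr_sumr.
  under [RHS]eq_bigr => u _ do rewrite exchange_big.
  rewrite [RHS]exchange_big; apply: eq_bigr => b _ /=.
  rewrite normCK {1}/H mulr_suml; apply: eq_bigr => u _.
  have -> : (H (a + b + y0)%N)^* = \sum_(u' <- us) c u' * (phi (u' * x * (a + b + y0))%N)^*.
    by rewrite rmorph_sum; apply: eq_bigr => u' _; rewrite rmorphM /= conjCK.
  by rewrite mulr_sumr; apply: eq_bigr => u' _; rewrite !mulnA; ring.
have diag : \sum_(t <- pairs | t.1 == t.2) (c t.1)^* * c t.2 * G x t = (4 * N ^ 2)%:R * E x.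
  rewrite big_mkcond big_allpairs mulr_sumr big_seq [RHS]big_seq; apply: eq_bigr => u uus /=.
  rewrite (bigD1_seq u) //= eqxx big1 ?addr0 => [|u' /negPf]; last by rewrite eq_sym => ->.
  have -> : G x (u, u) = (4 * N ^ 2)%:R.
    rewrite /G /=; under eq_bigr => a _ do under eq_bigr => b _ do rewrite -normCK phi_norm expr1n.
    by rewrite !sumr_const !card_ord -mulrnA; congr (_%:R); lia.
  by rewrite mulrC normCK [c u * _]mulrC.
have off : `|\sum_(t <- pairs | t.1 != t.2) (c t.1)^* * c t.2 * G x t| <= E x * W x.
  rewrite -ler_sqr ?nnegrE ?mulr_ge0 ?W_ge0 ?E_ge0 //.
  apply: le_trans (cauchy_schwarz _ _ _ _) _; rewrite exprMn sqrtCK.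
  rewrite ler_wpM2r ?sumr_ge0 // => [*|]; first by rewrite exprn_ge0.
  apply: le_trans (_ : \sum_(t <- pairs) `|c t.1| ^+ 2 * `|c t.2| ^+ 2 <= _).
    rewrite big_mkcond; apply: ler_sum => t _; case: ifP => _; last by rewrite mulr_ge0 ?exprn_ge0.
    by rewrite normrM norm_conjC exprMn.
  rewrite big_allpairs /= expr2 mulr_suml le_eqVlt; apply/orP; left; apply/eqP.
  by apply: eq_bigr => u _; rewrite mulr_sumr.
have [E0|E0] := eqVneq (E x) 0; first by rewrite E0 addr_ge0 ?W_ge0.
have Egt0 : 0 < E x by rewrite lt_def E0 E_ge0.
rewrite -(ler_pM2l Egt0) -expr2; apply: le_trans E2 _.
rewrite -[X in X <= _]ger0_norm; last by do 2 (apply: sumr_ge0 => ? _); rewrite exprn_ge0.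
rewrite HG (bigID (fun t => t.1 == t.2)) /= diag.
apply: le_trans (ler_normD _ _) _; rewrite mulrDr lerD //.
by rewrite ger0_norm ?mulr_ge0 ?E_ge0 // mulrC.
Qed.

Lemma W_sq_sum : \sum_(x < M | coprime x M) W x ^+ 2 <=
  (size us ^ 2)%:R * (2%:R * ((2 * N) ^ 4)%:R * S ^+ 2 / M%:R + 2%:R * ((M * (2 * N)) ^ 2)%:R).
Proof.
have [z pz] := closed_prim_root_exists C M_gt0.
under eq_bigr do rewrite sqrtCK.
rewrite exchange_big /= big_seq_cond.
set V := 2%:R * ((2 * N) ^ 4)%:R * S ^+ 2 / M%:R + _.
apply: le_trans (_ : \sum_(t <- pairs) V <= _); last first.
  by rewrite big_const_seq count_predT iter_addr_0 size_allpairs mulr_natl mulnn.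
rewrite -big_seq_cond big_mkcond big_seq [X in _ <= X]big_seq.
apply: ler_sum => -[u u'] /allpairsP[[v v'] [/= vus v'us [-> ->]]].
have V0 : 0 <= V by rewrite addr_ge0 ?divr_ge0 ?mulr_ge0 ?exprn_ge0 ?ler0n.
case: ifP => //= vv'.
pose f r := phi (v * r) * (phi (v' * r))^*.
apply: le_trans (variance_bound (f := f) M_gt0 pz _ _ (2 * N) y0) _.
- by move=> n; rewrite /f !(phi_mod (modnMmr _ _ _)).
- by move=> n; rewrite /f normrM norm_conjC !phi_norm mulr1.
rewrite /V lerD2r ler_wpM2r ?invr_ge0 ?ler0n // ler_wpM2l ?mulr_ge0 ?ler0n //.
by rewrite ler_pXn2r ?nnegrE ?normr_ge0 // S_bound.
Qed.

(** Summing [dual_bound] over at most M units gives the first term. For the second, the factor M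
    from Cauchy-Schwarz over the units cancels the 1 / M in front of S^2 in [W_sq_sum]. *)
Lemma unit_sum_bound :
  (size us)%:R * \sum_(x < M | coprime x M) `|\sum_(i < N) g i * phi (x * (c0 + i))| ^+ 2 <=
  (4 * N ^ 2 * M)%:R +
  (size us)%:R * sqrtC ((32 * N ^ 4)%:R * S ^+ 2 + (8 * M ^ 3 * N ^ 2)%:R).
Proof.
have -> : (size us)%:R * \sum_(x < M | coprime x M) `|\sum_(i < N) g i * phi (x * (c0 + i))| ^+ 2 =
    \sum_(x < M | coprime x M) E x.
  rewrite exchange_big /= big_seq.
  rewrite [RHS](eq_bigr (fun=> \sum_(x < M | coprime x M) `|\sum_(i < N) g i * phi (x * (c0 + i))| ^+ 2)).
    by rewrite -big_seq big_const_seq count_predT iter_addr_0 mulr_natl.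
  move=> u uus; pose F x := `|\sum_(i < N) g i * phi (x * (c0 + i))| ^+ 2.
  rewrite -(units_dilation (F := F) _ (us_coprime uus)) // => n.
  by rewrite /F; congr (`|_| ^+ 2); apply: eq_bigr => i _; rewrite (phi_mod (modnMml _ _ _)).
apply: le_trans (_ : \sum_(x < M | coprime x M) ((4 * N ^ 2)%:R + W x) <= _).
  by apply: ler_sum => x _; apply: dual_bound.
rewrite big_split /= lerD //.
  apply: le_trans (_ : \sum_(x < M) (4 * N ^ 2)%:R <= _).
    by rewrite big_mkcond; apply: ler_sum => x _; case: ifP.
  by rewrite sumr_const card_ord -mulrnA.
have SW0 : 0 <= \sum_(x < M | coprime x M) W x by apply: sumr_ge0 => x _; apply: W_ge0.
have B0 : 0 <= (32 * N ^ 4)%:R * S ^+ 2 + (8 * M ^ 3 * N ^ 2)%:R :> C.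
  by rewrite addr_ge0 ?mulr_ge0 ?exprn_ge0 ?ler0n.
rewrite -ler_sqr ?nnegrE ?mulr_ge0 ?sqrtC_ge0 // exprMn sqrtCK.
apply: le_trans (_ : M%:R * \sum_(x < M | coprime x M) W x ^+ 2 <= _).
  have := cauchy_schwarz_pos (index_enum 'I_M) (fun x => coprime x M) (x := fun=> 1)
    (y := fun x => W x) (fun=> ler01) (fun x => W_ge0 x).
  rewrite /=; under eq_bigr do rewrite mul1r.
  move/le_trans; apply; rewrite ler_wpM2r ?sumr_ge0 // => [*|]; first by rewrite exprn_ge0 // W_ge0.
  under eq_bigr do rewrite expr1n.
  by rewrite sumr_const ler_nat -[X in (_ <= X)%N](card_ord M) max_card.
apply: le_trans (ler_wpM2l (ler0n _ _) W_sq_sum) _.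
rewrite mulrCA natrX ler_wpM2l ?exprn_ge0 // le_eqVlt; apply/orP; left; apply/eqP.
have MN0 : M%:R != 0 :> C by rewrite pnatr_eq0 -lt0n.
by rewrite !(natrX, natrM); field.
Qed.
End Duality.

(** * Complete sums over subgroups of F_p *)

Lemma periodic_sum (V : nmodType) (h : nat -> V) m M :
  (forall n, h (n %% M)%N = h n) -> (0 < M)%N ->
  \sum_(k < m * M) h k = (\sum_(k < M) h k) *+ m.
Proof.
move=> hper M0; elim: m => [|m IH]; first by rewrite mul0n big_ord0 mulr0n.
rewrite mulSn addnC big_split_ord /= IH mulrSr; congr (_ + _).
by apply: eq_bigr => i _; rewrite -hper modnMDl hper.
Qed.

Lemma prim_root_sum (F : finFieldType) (V : nmodType) (h : F -> V) M (mu : F) :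
  M.-primitive_root mu -> \sum_(r < M) h (mu ^+ r) = \sum_(z | z ^+ M == 1) h z.
Proof.
move=> pm; rewrite -(big_map (fun r : 'I_M => mu ^+ r) xpredT h).
rewrite -[RHS]big_filter; apply: perm_big; apply: uniq_perm.
- rewrite map_inj_uniq ?index_enum_uniq // => i j /eqP; rewrite (eq_prim_root_expr pm).
  by rewrite !modn_small // => /eqP/val_inj.
- by rewrite filter_uniq // index_enum_uniq.
move=> z; rewrite mem_filter mem_index_enum andbT; apply/mapP/eqP.
  by case=> r _ ->; rewrite -exprM mulnC exprM (prim_expr_order pm) expr1n.
by move/(prim_rootP pm) => [i ->]; exists i; rewrite ?mem_index_enum.
Qed.

Lemma Fp_prim_root_exists p : prime p -> exists g : 'F_p, p.-1.-primitive_root g.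
Proof.
move=> p_pr; have p1 : (0 < p.-1)%N by have := prime_gt1 p_pr; lia.
have /hasP[g _ pg] : has (p.-1).-primitive_root [seq x <- enum 'F_p | x != 0].
  apply: has_prim_root => //.
  - apply/allP => x; rewrite mem_filter => /andP[x0 _].
    rewrite unity_rootE -(inj_eq (mulfI x0)) mulr1 -exprS prednK ?prime_gt0 //.
    by have := expf_card x; rewrite card_Fp // => ->.
  - by rewrite filter_uniq // enum_uniq.
  have := count_predC (pred1 (0 : 'F_p)) (enum 'F_p).
  rewrite -cardE card_Fp // (count_uniq_mem _ (enum_uniq _)) mem_enum size_filter => e.
  by rewrite -[X in (X.-1 <= _)%N]e.
by exists g.
Qed.

Lemma size_XnsubXn (F : fieldType) (a : F) i j : a != 0 -> i != j ->
  size (a *: ('X^i - 'X^j) : {poly F}) = (maxn i j).+1.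
Proof.
move=> a0; wlog lij : a i j a0 / (j < i)%N => [hw|_].
  rewrite neq_ltn => /orP[lij|lji]; last by apply: hw => //; rewrite gtn_eqF.
  rewrite -opprB scalerN -scaleNr maxnC; apply: hw; rewrite ?oppr_eq0 //.
  by rewrite gtn_eqF.
by rewrite size_scale // size_polyDl ?size_polyN !size_polyXn // (maxn_idPl (ltnW lij)).
Qed.

Section SubgroupSums.
Variables (p : nat) (C : numClosedFieldType) (psi : 'F_p -> C).
Hypothesis C_archi : forall x : C, exists n : nat, `|x| <= n%:R.
Hypothesis p_pr : prime p.
Hypotheses (psiD : forall a b, psi (a + b) = psi a * psi b) (psi0 : psi 0 = 1).
Hypotheses (psi_norm : forall a, `|psi a| = 1) (psi_neq1 : exists a, psi a != 1).

Lemma psi_conj a : (psi a)^* = psi (- a).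
Proof.
have psia : psi a != 0 by rewrite -normr_gt0 psi_norm.
apply: (mulfI psia); rewrite -normCK psi_norm expr1n -psiD subrr psi0 //.
Qed.

(** The map x -> x^m covers each element of the subgroup m times as x runs over the nonzero
    residues. The term 1 from x = 0 is at most p^(1/2) and fits into the gap between d - 1 and d.
    The condition B <= M keeps the degree at most m M = p - 1. *)
Lemma subgroup_weil_bound (a mu : 'F_p) M B u v :
  a != 0 -> M.-primitive_root mu -> (M %| p.-1)%N -> (B <= M)%N ->
  (0 < u <= B)%N -> (0 < v <= B)%N -> u != v ->
  `|\sum_(r < M) psi (a * mu ^+ (u * r)) * (psi (a * mu ^+ (v * r)))^*| <=
  B%:R * sqrtC p%:R.
Proof.
move=> a0 pm Mp BM /andP[u0 uB] /andP[v0 vB] uv.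
have p_gt1 := prime_gt1 p_pr.
have M0 := prim_order_gt0 pm.
pose m := (p.-1 %/ M)%N; have mM : (m * M = p.-1)%N by rewrite divnK.
have m0 : (0 < m)%N by rewrite divn_gt0 // dvdn_leq //; lia.
pose h (z : 'F_p) := psi (a * (z ^+ u - z ^+ v)).
have -> : \sum_(r < M) psi (a * mu ^+ (u * r)) * (psi (a * mu ^+ (v * r)))^* = \sum_(r < M) h (mu ^+ r).
  apply: eq_bigr => r _; rewrite psi_conj -psiD /h mulrBr.
  by rewrite -!exprM ![(r * _)%N]mulnC.
have [g pg] := Fp_prim_root_exists p_pr.
have pgm : M.-primitive_root (g ^+ m) by apply: dvdn_prim_root.
pose f : {poly 'F_p} := a *: ('X^(m * u) - 'X^(m * v)).
have muv : (m * u)%N != (m * v)%N by rewrite eqn_pmul2l.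
have szf := size_XnsubXn a0 muv; rewrite -/f in szf.
have d0 : (0 < maxn (m * u) (m * v))%N by rewrite leq_max muln_gt0 m0 u0.
have dB : (maxn (m * u) (m * v) <= m * B)%N by rewrite geq_max !leq_mul2l uB vB !orbT.
have dp : (maxn (m * u) (m * v) < p)%N.
  apply: leq_ltn_trans dB _; apply: leq_ltn_trans (leq_mul (leqnn m) BM) _.
  by rewrite mM prednK // ltnW.
have sumE : m%:R * \sum_(r < M) h (mu ^+ r) = \sum_(x : 'F_p) psi f.[x] - 1.
  rewrite (prim_root_sum h pm) -(prim_root_sum h pgm) mulr_natl.
  rewrite -(periodic_sum (h := fun r => h ((g ^+ m) ^+ r))) //; last first.
    by move=> n; rewrite prim_expr_mod.
  rewrite mM; under eq_bigr => k _ do rewrite exprAC.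
  rewrite (prim_root_sum (fun z => h (z ^+ m)) pg) [in RHS](bigD1 0) //=.
  have -> : f.[0] = 0 by rewrite !hornerE !expr0n !muln_eq0 !gtn_eqF ?subrr ?mulr0 // ltnW.
  rewrite psi0 [1 + _]addrC addrK; apply: eq_big => [z|z _].
    have [->|z0] := eqVneq z 0.
      have p1 : (p.-1 == 0)%N = false by apply/negP => /eqP; lia.
      by rewrite expr0n p1 eq_sym oner_eq0.
    apply/eqP; apply: (mulfI z0); rewrite mulr1 -exprS prednK ?prime_gt0 //.
    by have := expf_card z; rewrite card_Fp.
  by rewrite /h /f !hornerE -!exprM.
have W := weil_bound C_archi p_pr psiD psi0 psi_norm psi_neq1 szf d0 dp.
have sp1 : 1 <= sqrtC (p%:R : C).
  have : sqrtC 1 <= sqrtC (p%:R : C) by rewrite ler_sqrtC ?qualifE /= ?ler01 ?ler0n // ler1n prime_gt0.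
  by rewrite sqrtC1.
have mR0 : (0 < m%:R :> C) by rewrite ltr0n.
rewrite -(ler_pM2l mR0) -{1}(ger0_norm (ltW mR0)) -normrM sumE.
apply: le_trans (ler_normB _ _) _; rewrite normr1.
apply: le_trans (_ : (maxn (m * u) (m * v)).-1%:R * sqrtC p%:R + sqrtC p%:R <= _).
  by rewrite lerD.
rewrite -[X in _ + X]mul1r -mulrDl.
by rewrite mulrA ler_wpM2r ?sqrtC_ge0 ?ler0n // -natrM -(natrD _ _ 1) ler_nat addn1 prednK.
Qed.
End SubgroupSums.

Lemma gcd_partition (V : nmodType) (F : nat -> V) T : (0 < T)%N ->
  \sum_(x < T) F x =
  \sum_(d <- divisors T) \sum_(x < T %/ d | coprime x (T %/ d)) F (d * x)%N.
Proof.
move=> T0; rewrite -(big_mkord xpredT) /index_iota subn0.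
transitivity (\sum_(d <- divisors T) \sum_(x <- iota 0 T | gcdn x T == d) F x).
  under [RHS]eq_bigr do rewrite big_mkcond.
  rewrite exchange_big; apply: eq_bigr => x _ /=.
  rewrite (bigD1_seq (gcdn x T)) ?divisors_uniq //=; last by rewrite -dvdn_divisors // dvdn_gcdr.
  by rewrite eqxx big1 ?addr0 // => d; rewrite eq_sym => /negPf ->.
rewrite big_seq [RHS]big_seq; apply: eq_bigr => d; rewrite -dvdn_divisors // => dT.
have d0 : (0 < d)%N by apply: dvdn_gt0 dT.
rewrite -(big_mkord (fun x => coprime x (T %/ d)) (fun x => F (d * x)%N)) /index_iota subn0.
rewrite -[LHS]big_filter -[RHS]big_filter -(big_map (muln d) xpredT); apply: perm_big; apply: uniq_perm.
- by rewrite filter_uniq ?iota_uniq.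
- by rewrite map_inj_uniq ?filter_uniq ?iota_uniq // => x y /eqP; rewrite eqn_pmul2l // => /eqP.
have Td : T = (d * (T %/ d))%N by rewrite mulnC divnK.
move=> x; rewrite mem_filter mem_iota add0n; apply/idP/mapP => [/andP[/eqP gx /= xT]|[y]].
  have dx : (d %| x)%N by rewrite -gx dvdn_gcdl.
  exists (x %/ d)%N; last by rewrite mulnC divnK.
  rewrite mem_filter mem_iota add0n /= ltn_divLR // divnK // xT andbT.
  by rewrite /coprime -(eqn_pmul2l d0) muln1 muln_gcdr mulnC divnK // -Td gx.
rewrite mem_filter mem_iota add0n => /andP[cy /= yT] ->.
rewrite {1 2}Td -muln_gcdr (eqP cy) muln1 eqxx /= ltn_mul2l d0 //.
Qed.

Local Open Scope complex_scope.

(** * The double sum *)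

Section ComplexReals.
Variable R : realType.

Lemma complex_archi (x : R[i]) : exists n : nat, `|x| <= n%:R.
Proof.
rewrite normc_def; set r := Num.sqrt _; exists (Num.bound r).
have r0 : 0 <= r by apply: sqrtr_ge0.
by rewrite -(rmorph_nat (real_complex R)) lecR ltW // archi_boundP.
Qed.

Lemma sqrtC_of_real (x : R) : 0 <= x -> sqrtC x%:C = (Num.sqrt x)%:C.
Proof.
move=> x0; rewrite -{1}(sqr_sqrtr x0) rmorphXn /=; apply: sqrCK.
by rewrite ler0c sqrtr_ge0.
Qed.

Lemma normc_real (z : R[i]) : (complex.Re `|z|)%:C = `|z|.
Proof. by apply: RRe_real; apply: normr_real. Qed.

Lemma e_E (m : nat) (z : int) : e_ R m z =
  cos (2 * pi * z%:~R / m%:R) +i* sin (2 * pi * z%:~R / m%:R).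
Proof.
rewrite /e_.
have -> : (2 * pi)%:C * 'i%C * z%:~R / m%:R = 'i%C * (2 * pi * z%:~R / m%:R)%:C :> R[i].
  rewrite [in RHS]rmorphM [in RHS]rmorphM fmorphV rmorph_nat rmorph_int /=; ring.
by rewrite /cexp /=; simpc; rewrite /= ?expR0 ?mul1r.
Qed.

Variable p : nat.
Hypothesis p_pr : prime p.
Let p_neq0 : p%:R != 0 :> R.
Proof. by rewrite pnatr_eq0 -lt0n prime_gt0. Qed.

Lemma e_D (z w : int) : e_ R p (z + w) = e_ R p z * e_ R p w.
Proof.
rewrite !e_E rmorphD /= mulrDr mulrDl cosD sinD; simpc.
by congr (_ +i* _); ring.
Qed.

Lemma e_0 : e_ R p 0 = 1.
Proof. by rewrite e_E rmorph0 mulr0 mul0r cos0 sin0. Qed.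

Lemma e_p (z : int) : e_ R p (p%:Z * z) = 1.
Proof.
have H (n : nat) : e_ R p (p%:Z * n%:Z) = 1.
  elim: n => [|n IH]; first by rewrite mulr0 e_0.
  rewrite intS mulrDr mulr1 e_D IH mulr1 e_E.
  rewrite (_ : 2 * pi * (p%:Z)%:~R / p%:R = pi *+ 2); last first.
    by rewrite -pmulrn mulfK // mulr_natl.
  by rewrite cos2pi sin2pi.
case: z => n; first exact: H.
have := e_D (p%:Z * Negz n) (p%:Z * n.+1%:Z).
by rewrite -mulrDr NegzE addNr mulr0 e_0 H mulr1.
Qed.

Lemma e_norm (z : int) : `|e_ R p z| = 1.
Proof. by rewrite e_E normc_def /= cos2Dsin2 sqrtr1. Qed.

Definition add_char (a : 'F_p) : R[i] := e_ R p (a : nat)%:Z.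

Lemma add_char_nat (n : nat) : add_char n%:R = e_ R p n%:Z.
Proof.
by rewrite /add_char val_Fp_nat // {2}(divn_eq n p) PoszD PoszM e_D [_ * p%:Z]mulrC e_p mul1r.
Qed.

Lemma add_char_int (z : int) : add_char z%:~R = e_ R p z.
Proof.
case: z => n; first by rewrite add_char_nat.
have -> : (Negz n)%:~R = (p.-1 * n.+1)%:R :> 'F_p.
  have e : p.-1%:R = -1 :> 'F_p.
    by apply/eqP; rewrite -addr_eq0 natr1 prednK ?prime_gt0 // pchar_Fp_0.
  by rewrite NegzE rmorphN natrM e mulN1r.
rewrite add_char_nat NegzE.
have -> : (p.-1 * n.+1)%N%:Z = - n.+1%:Z + p%:Z * n.+1%:Z.
  have -> : p%:Z = 1 + p.-1%:Z by rewrite -intS prednK // prime_gt0.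
  by rewrite PoszM; ring.
by rewrite e_D e_p mulr1.
Qed.

Lemma add_charD a b : add_char (a + b) = add_char a * add_char b.
Proof.
rewrite -[a]natr_Zp -[b]natr_Zp -natrD !add_char_nat PoszD; exact: e_D.
Qed.

Lemma add_char0 : add_char 0 = 1.
Proof. by rewrite (add_char_nat 0) e_0. Qed.

Lemma add_char_norm a : `|add_char a| = 1.
Proof. exact: e_norm. Qed.

Lemma add_char_neq1 : exists a, add_char a != 1.
Proof.
exists 1%:R; rewrite add_char_nat e_E; apply/eqP => -[c1 s0].
have p_gt1 := prime_gt1 p_pr.
have p0 : 0 < p%:R :> R by rewrite ltr0n prime_gt0.
have pi0 : 0 < pi :> R by apply: pi_gt0.
(* For p = 2 the angle is pi, where the sine vanishes and only the cosine tells the value from 1. *)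
have [p2|p2] := eqVneq p 2%N.
  move: c1; rewrite p2 mulr1 mulrC mulKf ?pnatr_eq0 // cospi => /eqP.
  by rewrite -subr_eq0; lra.
have p3 : (3 <= p)%N by lia.
have : 0 < sin (2 * pi * 1%:~R / p%:R) :> R.
  apply: sin_gt0_pi; rewrite mulr1 divr_gt0 ?mulr_gt0 //= ltr_pdivrMr // mulrC ltr_pM2l //.
  by rewrite ltr_nat.
by rewrite s0 ltxx.
Qed.

End ComplexReals.

(** * The mean square for one modulus *)

Section RealBounds.
Variable R : realType.

(** The norm of R[i] takes values in R[i]; real powers and real square roots require an element of
    R. *)
Definition rnorm (z : R[i]) : R := complex.Re `|z|.

Lemma rnormE z : (rnorm z)%:C = `|z|. Proof. exact: normc_real. Qed.

Lemma rnorm_ge0 z : 0 <= rnorm z.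
Proof. by rewrite -(ler0c (rnorm z)) rnormE. Qed.

Variable p : nat.
Hypothesis p_pr : prime p.
Local Notation psi := (@add_char R p).

Section OneModulus.
Variables (a mu : 'F_p) (M : nat) (g : nat -> R[i]) (c0 N : nat).
Hypotheses (a_neq0 : a != 0) (mu_prim : M.-primitive_root mu) (M_dvd : (M %| p.-1)%N)
  (g_le1 : forall n, `|g n| <= 1).

Definition unit_energy : R :=
  \sum_(x < M | coprime x M) rnorm (\sum_(i < N) g i * psi (a * mu ^+ (x * (c0 + i)))) ^+ 2.

Lemma unit_energy_trivial : unit_energy <= N%:R ^+ 2 * M%:R.
Proof.
have -> : N%:R ^+ 2 * M%:R = \sum_(x < M) N%:R ^+ 2 :> R.
  by rewrite sumr_const card_ord mulr_natr.
rewrite /unit_energy big_mkcond; apply: ler_sum => x _; case: ifP => _; last by rewrite exprn_ge0.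
rewrite ler_pXn2r ?nnegrE ?rnorm_ge0 ?ler0n // -lecR rnormE rmorph_nat.
apply: le_trans (ler_norm_sum _ _ _) _.
apply: le_trans (_ : \sum_(i < N) 1 <= _); last by rewrite sumr_const card_ord.
by apply: ler_sum => i _; rewrite normrM add_char_norm mulr1.
Qed.

Lemma unit_energy_bound B : (B <= M)%N ->
  (count (coprime^~ M) (iota 1 B))%:R * unit_energy <=
  4 * N%:R ^+ 2 * M%:R + (count (coprime^~ M) (iota 1 B))%:R *
    Num.sqrt (32 * N%:R ^+ 4 * (B%:R ^+ 2 * p%:R) + 8 * M%:R ^+ 3 * N%:R ^+ 2).
Proof.
move=> BM; have M0 := prim_order_gt0 mu_prim.
pose us := [seq u <- iota 1 B | coprime u M].
have szus : size us = count (coprime^~ M) (iota 1 B) by rewrite size_filter.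
have usP u : u \in us -> coprime u M /\ (0 < u <= B)%N.
  by rewrite mem_filter mem_iota add1n ltnS => /andP[].
pose phi r := psi (a * mu ^+ r).
have phi_per n : phi (n %% M)%N = phi n by rewrite /phi prim_expr_mod.
have phi_norm n : `|phi n| = 1 by apply: add_char_norm.
have S0 : 0 <= B%:R * sqrtC p%:R :> R[i] by rewrite mulr_ge0 ?sqrtC_ge0 ?ler0n.
have := @unit_sum_bound _ M phi M0 phi_per phi_norm g c0 N us (B%:R * sqrtC p%:R) S0 g_le1
  (filter_uniq _ (iota_uniq _ _)) (fun u uus => (usP u uus).1).
rewrite szus; set n := count _ _ => H.
rewrite -lecR !(rmorphD, rmorphM, rmorphXn, rmorph_nat) /=.
have rad0 : 0 <= 32 * N%:R ^+ 4 * (B%:R ^+ 2 * p%:R) + 8 * M%:R ^+ 3 * N%:R ^+ 2 :> R.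
  by rewrite addr_ge0 ?mulr_ge0 ?exprn_ge0 ?ler0n.
rewrite -(sqrtC_of_real rad0).
have -> : (unit_energy)%:C = \sum_(x < M | coprime x M) `|\sum_(i < N) g i * phi (x * (c0 + i))%N| ^+ 2.
  by rewrite rmorph_sum; apply: eq_bigr => x _; rewrite rmorphXn /= rnormE.
rewrite exprMn sqrtCK in H.
have E4 : (4 * N ^ 2 * M)%:R = 4 * N%:R ^+ 2 * M%:R :> R[i] by rewrite 2!natrM natrX.
have E32 : (32 * N ^ 4)%:R = 32 * N%:R ^+ 4 :> R[i] by rewrite natrM natrX.
have E8 : (8 * M ^ 3 * N ^ 2)%:R = 8 * M%:R ^+ 3 * N%:R ^+ 2 :> R[i] by rewrite 2!natrM 2!natrX.
rewrite E4 E32 E8 in H.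
rewrite !(rmorphD, rmorphM, rmorphXn, rmorph_nat) /=; apply: H.
move=> u v uus vus uv.
have [_ uB] := usP u uus; have [_ vB] := usP v vus.
apply: (subgroup_weil_bound (@complex_archi R) p_pr) => //.
- exact: add_charD.
- exact: add_char0.
- exact: add_char_norm.
- exact: add_char_neq1.
Qed.

End OneModulus.

(* [n4], [t4], [m4] and [P] stand for the fourth roots of [N], [T], [M] and
   [p]; the dilations are taken up to [B], of order [M^(1/2) p^(-1/4)]. *)
Lemma modulus_ineq (n4 t4 m4 P tau D : R) :
  1 <= n4 -> 1 <= m4 -> m4 <= t4 -> 1 <= P -> t4 <= P -> n4 <= P -> 1 <= tau ->
  D <= n4 ^+ 8 * m4 ^+ 4 ->
  (P <= m4 ^+ 2 -> exists B n : R, [/\ 0 < n, m4 ^+ 2 / P <= 2 * B, B <= m4 ^+ 2 / P,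
     B <= 4 * tau * n &
     n * D <= 4 * n4 ^+ 8 * m4 ^+ 4 + n * (6 * n4 ^+ 8 * B * P ^+ 2 + 3 * n4 ^+ 4 * m4 ^+ 6)]) ->
  D <= 41 * tau * (n4 ^+ 6 * P ^+ 3 * t4 ^+ 2).
Proof.
move=> n1 m1 mt P1 tP nP tau1 Dtriv Dmain.
have n0 : 0 < n4 by lra. have m0 : 0 < m4 by lra. have t0 : 0 < t4 by lra.
have P0 : 0 < P by lra.
have n0w := ltW n0; have m0w := ltW m0; have t0w := ltW t0; have P0w := ltW P0.
set Q := n4 ^+ 6 * P ^+ 3 * t4 ^+ 2.
have Q0 : 0 < Q by rewrite /Q !mulr_gt0 ?exprn_gt0.
have QtQ : Q <= 41 * tau * Q by rewrite ler_peMl ?(ltW Q0) //; lra.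
have pw (x y : R) k : 0 <= x -> x <= y -> x ^+ k <= y ^+ k.
  by move=> x0 xy; rewrite lerXn2r ?nnegrE //; lra.
have mt4 : m4 ^+ 4 <= t4 ^+ 4 by apply: pw => //; lra.
(* If N T <= p^(3/2), the trivial bound N^2 M suffices. *)
have [le3|gt3] := lerP (n4 ^+ 2 * t4 ^+ 2) (P ^+ 3).
  apply: le_trans Dtriv _; apply: le_trans QtQ.
  apply: le_trans (_ : n4 ^+ 6 * t4 ^+ 2 * (n4 ^+ 2 * t4 ^+ 2) <= _).
    rewrite (_ : n4 ^+ 6 * t4 ^+ 2 * (n4 ^+ 2 * t4 ^+ 2) = n4 ^+ 8 * t4 ^+ 4); last by ring.
    by rewrite ler_wpM2l // exprn_ge0 // ltW.
  rewrite (_ : Q = n4 ^+ 6 * t4 ^+ 2 * P ^+ 3); last by rewrite /Q; ring.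
  by rewrite ler_wpM2l // mulr_ge0 // exprn_ge0 // ltW.
(* Since N, T <= p, the remaining range has both T and N at least p^(1/2). The first settles the
   case M < p^(1/2), the second controls the term N M^(3/2) in [H2]. *)
have tP2 : P <= t4 ^+ 2.
  have nP2 : n4 ^+ 2 <= P ^+ 2 by apply: pw => //; lra.
  rewrite leNgt; apply/negP => tP2.
  have : n4 ^+ 2 * t4 ^+ 2 <= P ^+ 2 * P by rewrite ler_pM ?exprn_ge0 // ltW.
  by rewrite -exprSr; lra.
have nP2' : P <= n4 ^+ 2.
  have tPP : t4 ^+ 2 <= P ^+ 2 by apply: pw => //; lra.
  rewrite leNgt; apply/negP => nPl.
  have : n4 ^+ 2 * t4 ^+ 2 <= P * P ^+ 2 by rewrite ler_pM ?exprn_ge0 // ltW.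
  by rewrite -exprS; lra.
have nPP : n4 ^+ 2 <= P ^+ 2 by apply: pw => //; lra.
(* If M < p^(1/2), the optimal B would be below 1 and no dilation is available; the trivial bound
   suffices again. *)
have [Pm|mP] := lerP P (m4 ^+ 2); last first.
  apply: le_trans Dtriv _; apply: le_trans QtQ.
  apply: le_trans (_ : n4 ^+ 8 * P ^+ 2 <= _).
    rewrite ler_wpM2l ?exprn_ge0 // (_ : m4 ^+ 4 = (m4 ^+ 2) ^+ 2); last by ring.
    by apply: pw; rewrite ?exprn_ge0 // ltW.
  rewrite (_ : n4 ^+ 8 * P ^+ 2 = n4 ^+ 6 * P ^+ 2 * n4 ^+ 2); last by ring.
  rewrite (_ : Q = n4 ^+ 6 * P ^+ 2 * (P * t4 ^+ 2)); last by rewrite /Q; ring.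
  rewrite ler_wpM2l ?mulr_ge0 ?exprn_ge0 //; apply: le_trans nPP _.
  by rewrite expr2 ler_wpM2l // ltW.
have [B [n [n_gt0 bB Bb Bn main]]] := Dmain Pm.
set b := m4 ^+ 2 / P in bB Bb.
have bP : b * P = m4 ^+ 2 by rewrite /b divfK // gt_eqF.
have b0 : 0 < b by rewrite /b divr_gt0 ?exprn_gt0.
have H1 : n4 ^+ 8 * m4 ^+ 2 * P <= Q.
  rewrite (_ : n4 ^+ 8 * m4 ^+ 2 * P = n4 ^+ 6 * P * (n4 ^+ 2 * m4 ^+ 2)); last by ring.
  rewrite (_ : Q = n4 ^+ 6 * P * (P ^+ 2 * t4 ^+ 2)); last by rewrite /Q; ring.
  rewrite ler_wpM2l ?mulr_ge0 ?exprn_ge0 // ler_pM ?exprn_ge0 //.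
  by apply: pw => //; lra.
have H2 : n4 ^+ 4 * m4 ^+ 6 <= Q.
  apply: le_trans (_ : n4 ^+ 4 * t4 ^+ 6 <= _).
    by rewrite ler_wpM2l ?exprn_ge0 //; apply: pw => //; lra.
  rewrite (_ : n4 ^+ 4 * t4 ^+ 6 = n4 ^+ 4 * t4 ^+ 2 * t4 ^+ 4); last by ring.
  rewrite (_ : Q = n4 ^+ 4 * t4 ^+ 2 * (n4 ^+ 2 * P ^+ 3)); last by rewrite /Q; ring.
  rewrite ler_wpM2l ?mulr_ge0 ?exprn_ge0 //.
  apply: le_trans (_ : P * P ^+ 3 <= _); last by rewrite ler_wpM2r ?exprn_ge0.
  by rewrite -exprS; apply: pw => //; lra.
have H3 : 6 * n4 ^+ 8 * B * P ^+ 2 <= 6 * Q.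
  apply: le_trans (_ : 6 * (n4 ^+ 8 * m4 ^+ 2 * P) <= _); last by rewrite ler_wpM2l.
  rewrite -bP (_ : 6 * (n4 ^+ 8 * (b * P) * P) = 6 * n4 ^+ 8 * P ^+ 2 * b); last by ring.
  rewrite (_ : 6 * n4 ^+ 8 * B * P ^+ 2 = 6 * n4 ^+ 8 * P ^+ 2 * B); last by ring.
  by rewrite ler_wpM2l // ?mulr_ge0 ?exprn_ge0.
have H4 : 4 * n4 ^+ 8 * m4 ^+ 4 <= n * (32 * tau * Q).
  apply: le_trans (_ : n * (32 * tau * (n4 ^+ 8 * m4 ^+ 2 * P)) <= _); last first.
    by rewrite ler_wpM2l ?(ltW n_gt0) // ler_wpM2l //; lra.
  have X0 : 0 <= 4 * n4 ^+ 8 * m4 ^+ 2 * P by rewrite !mulr_ge0 ?exprn_ge0.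
  have : (4 * n4 ^+ 8 * m4 ^+ 2 * P) * b <= (4 * n4 ^+ 8 * m4 ^+ 2 * P) * (8 * tau * n).
    by rewrite ler_wpM2l //; lra.
  rewrite (_ : 4 * n4 ^+ 8 * m4 ^+ 2 * P * b = 4 * n4 ^+ 8 * m4 ^+ 2 * (b * P)); last by ring.
  rewrite bP (_ : 4 * n4 ^+ 8 * m4 ^+ 2 * m4 ^+ 2 = 4 * n4 ^+ 8 * m4 ^+ 4); last by ring.
  move/le_trans; apply; rewrite le_eqVlt; apply/orP; left; apply/eqP; ring.
rewrite -(ler_pM2l n_gt0); apply: le_trans main _.
(* The constant 41 is 32 + 9: 32 tau from the diagonal, through b <= 2 B <= 8 tau n, and 6 + 3 from
   the two square-root terms. *)
apply: le_trans (_ : n * (32 * tau * Q) + n * (9 * Q) <= _).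
  by rewrite lerD // ler_wpM2l ?(ltW n_gt0) //; lra.
rewrite -mulrDr ler_wpM2l ?(ltW n_gt0) //.
have : 0 <= (tau - 1) * Q by rewrite mulr_ge0 ?(ltW Q0) //; lra.
lra.
Qed.

End RealBounds.

(** * Choice of parameters and summation over the moduli *)

Section Assembly.
Variable R : realType.

Lemma powR_rootK (x : R) k : (0 < k)%N -> 0 <= x -> (x `^ (k%:R^-1)) ^+ k = x.
Proof.
move=> k0 x0; rewrite -powR_mulrn ?powR_ge0 // -powRrM mulVf ?powRr1 //.
by rewrite pnatr_eq0 -lt0n.
Qed.

Lemma powR_le (x y r : R) : 0 <= r -> 0 <= x -> x <= y -> x `^ r <= y `^ r.
Proof. by move=> r0 x0 xy; apply: ge0_ler_powR; rewrite ?nnegrE //; apply: le_trans xy. Qed.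

Lemma powR_ge1 (x r : R) : 0 <= r -> 1 <= x -> 1 <= x `^ r.
Proof. by move=> r0 x1; have := powR_le r0 ler01 x1; rewrite powR1. Qed.

Variable p : nat.
Hypothesis p_pr : prime p.

Lemma modulus_bound (a mu : 'F_p) M (g : nat -> R[i]) c0 N T (tau : R) :
  a != 0 -> M.-primitive_root mu -> (M %| p.-1)%N -> (forall n : nat, `|g n| <= 1) ->
  (0 < N <= p)%N -> (M <= T <= p)%N -> (size (divisors M))%:R <= tau ->
  unit_energy a mu M g c0 N <=
  41 * tau * ((N%:R `^ 4^-1) ^+ 6 * (p%:R `^ 4^-1) ^+ 3 * (T%:R `^ 4^-1) ^+ 2).
Proof.
move=> a0 pm Mp g1 /andP[N0 Np] /andP[MT Tp] dtau.
have M0 := prim_order_gt0 pm.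
have r0 : 0 <= 4^-1 :> R by rewrite invr_ge0.
have root4 n : ((n%:R : R) `^ 4^-1) ^+ 4 = n%:R by apply: powR_rootK.
have root1 n : (0 < n)%N -> 1 <= (n%:R : R) `^ 4^-1 by move=> n0; apply: powR_ge1; rewrite ?ler1n.
have rootle m n : (m <= n)%N -> (m%:R : R) `^ 4^-1 <= n%:R `^ 4^-1.
  by move=> mn; apply: powR_le; rewrite ?ler0n ?ler_nat.
set n4 := N%:R `^ _; set P := p%:R `^ _; set t4 := T%:R `^ _.
pose m4 : R := M%:R `^ 4^-1.
have NE : N%:R = n4 ^+ 4 by rewrite root4.
have ME : M%:R = m4 ^+ 4 by rewrite root4.
have pE : p%:R = P ^+ 4 by rewrite root4.
have n41 : 1 <= n4 by apply: root1.
have m41 : 1 <= m4 by apply: root1.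
have P1 : 1 <= P by apply: root1; rewrite prime_gt0.
have n4w : 0 <= n4 by apply: le_trans n41.
have m4w : 0 <= m4 by apply: le_trans m41.
have Pw : 0 <= P by apply: le_trans P1.
have d1 : 1 <= (size (divisors M))%:R :> R.
  by rewrite ler1n -has_predT; apply/hasP; exists 1%N; rewrite ?divisor1.
apply: (@modulus_ineq R n4 t4 m4 P tau) => //.
- exact: rootle.
- exact: rootle.
- exact: rootle.
- exact: le_trans dtau.
- have := @unit_energy_trivial R p a mu M g c0 N g1.
  by rewrite NE ME -exprM.
move=> Pm; set b := m4 ^+ 2 / P.
have P0 : 0 < P by lra.
have b1 : 1 <= b by rewrite ler_pdivlMr // mul1r.
have /andP[Bb bB] := truncn_itv (le_trans ler01 b1).
set B := Num.truncn b in Bb bB.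
have B1 : 1 <= B%:R :> R by rewrite ler1n truncn_gt_nat.
have BM : (B <= M)%N.
  rewrite -(ler_nat R); apply: le_trans Bb _; rewrite ler_pdivrMr // ME.
  apply: le_trans (_ : m4 ^+ 4 * 1 <= _); last by rewrite ler_wpM2l // exprn_ge0; lra.
  by rewrite mulr1 ler_weXn2l.
pose n := count (coprime^~ M) (iota 1 B).
have Bn : B%:R <= 4 * tau * n%:R.
  apply: le_trans (_ : 4 * (size (divisors M))%:R * n%:R <= _).
    by rewrite -!natrM ler_nat coprime_count.
  by rewrite ler_wpM2r // ler_wpM2l.
have n0 : 0 < n%:R :> R.
  rewrite lt_def ler0n andbT; apply: contraTneq Bn => ->; rewrite mulr0 -ltNge; lra.
exists B%:R, n%:R; split => //.
  by rewrite -natr1 in bB; lra.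
apply: le_trans (unit_energy_bound p_pr c0 N a0 pm Mp g1 BM) _; rewrite -/n.
have -> : 4 * N%:R ^+ 2 * M%:R = 4 * n4 ^+ 8 * m4 ^+ 4 by rewrite NE ME -exprM.
rewrite lerD2l ler_wpM2l ?ler0n //.
have y0 : 0 <= 6 * n4 ^+ 8 * B%:R * P ^+ 2 + 3 * n4 ^+ 4 * m4 ^+ 6.
  by apply: addr_ge0; repeat apply: mulr_ge0 => //; apply: exprn_ge0.
(* The root of a sum is at most the sum of the roots, with 6 and 3 rounding up the roots of 32 and
   8. *)
rewrite -[X in _ <= X](ger0_norm y0) -sqrtr_sqr ler_sqrt ?sqr_ge0 //.
rewrite NE ME pE -subr_ge0.
set z := _ - _.
have -> : z = 4 * n4 ^+ 16 * B%:R ^+ 2 * P ^+ 4 + n4 ^+ 8 * m4 ^+ 12 +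
    36 * (n4 ^+ 12 * B%:R * P ^+ 2 * m4 ^+ 6) by rewrite /z; ring.
by apply: addr_ge0; [apply: addr_ge0|]; repeat apply: mulr_ge0 => //; apply: exprn_ge0.
Qed.

(** The summand has period T in x, whence the factor (p - 1) / T. One [tau] is inherited from each
    modulus T / d, the other counts the divisors d. *)
Lemma energy_bound (a la : 'F_p) T (g : nat -> R[i]) c0 N (tau : R) :
  a != 0 -> T.-primitive_root la -> (T %| p.-1)%N -> (forall n : nat, `|g n| <= 1) ->
  (0 < N <= p)%N -> (forall M, (M %| T)%N -> (size (divisors M))%:R <= tau) ->
  \sum_(x < p.-1) rnorm (\sum_(i < N) g i * add_char R (a * la ^+ (x * (c0 + i)))) ^+ 2 <=
  (p.-1 %/ T)%:R * (41 * tau ^+ 2 * ((N%:R `^ 4^-1) ^+ 6 * (p%:R `^ 4^-1) ^+ 3 * (T%:R `^ 4^-1) ^+ 2)).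
Proof.
move=> a0 pl Tp g1 Np dtau; have T0 := prim_order_gt0 pl.
pose F x := rnorm (\sum_(i < N) g i * add_char R (a * la ^+ (x * (c0 + i)))) ^+ 2.
have p1 : (0 < p.-1)%N by have := prime_gt1 p_pr; lia.
rewrite -(divnK Tp) (periodic_sum (h := F)) //; last first.
  move=> n; rewrite /F; congr (rnorm _ ^+ 2); apply: eq_bigr => i _.
  by rewrite -(prim_expr_mod pl) modnMml (prim_expr_mod pl).
rewrite -[X in X <= _]mulr_natl mulnK //; apply: ler_wpM2l; first exact: ler0n.
set Q := _ * _ * (_ ^+ 2).
have Q0 : 0 <= Q by rewrite !mulr_ge0 ?exprn_ge0 ?powR_ge0.
have tau0 : 0 <= tau by apply: le_trans (dtau T (dvdnn _)); rewrite ler0n.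
rewrite gcd_partition //.
apply: le_trans (_ : \sum_(d <- divisors T) 41 * tau * Q <= _).
  rewrite big_seq [X in _ <= X]big_seq; apply: ler_sum => d; rewrite -dvdn_divisors // => dT.
  have dT' : (T %/ d %| T)%N by rewrite -{2}(divnK dT) dvdn_mulr.
  have pm : (T %/ d).-primitive_root (la ^+ d).
    by have := exp_prim_root pl d; rewrite (gcdn_idPl dT).
  have Tlp : (T <= p)%N by have := dvdn_leq p1 Tp; lia.
  have := @modulus_bound a (la ^+ d) (T %/ d) g c0 N T tau a0 pm (dvdn_trans dT' Tp) g1 Np _ (dtau _ dT').
  rewrite (dvdn_leq T0 dT') Tlp => /(_ isT); apply: le_trans.
  rewrite le_eqVlt; apply/orP; left; apply/eqP; apply: eq_bigr => x _.
  rewrite /F; congr (rnorm _ ^+ 2); apply: eq_bigr => i _.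
  by rewrite -exprM mulnA.
rewrite big_const_seq count_predT iter_addr_0 -[X in X <= _]mulr_natl.
apply: le_trans (ler_wpM2r _ (dtau T (dvdnn _))) _; first by apply: mulr_ge0 => //; apply: mulr_ge0.
rewrite le_eqVlt; apply/orP; left; apply/eqP; ring.
Qed.

End Assembly.

Theorem theorem2 (R : realType) (eta : R) (heta : 0 < eta) :
  exists C : R,
    forall (p T : nat) (lambda : 'F_p) (gamma : nat -> R[i]) (a : int)
           (K N : nat) (X : {set 'I_(p.-1)}),
      prime p ->
      (T %| p.-1)%N ->
      T.-primitive_root lambda ->
      (forall n : nat, `|gamma n| <= 1) ->
      coprimez a p%:Z ->
      (0 < K + 1 <= K + N)%N ->
      (K + N <= p.-1)%N ->
      T%:R * (p%:R `^ (- (1 / 2))) * ln (p%:R) ^+ 3 <= N%:R :> R ->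
      \sum_(x in X)
         `| \sum_(K + 1 <= y < (K + N).+1)
               gamma y * e_ R p (a * (lambda : nat)%:Z ^+ (x * y)) |
      <= (C * (#|X|%:R `^ (1 / 2) * N%:R `^ (3 / 4) * p%:R `^ (7 / 8 + eta)
                 / T%:R `^ (1 / 4)))%:C.
Proof.
(* This gives 1 / k <= eta, so the k-th root taken in the divisor bound costs at most p^eta. *)
pose k := (Num.bound (eta^-1)).
have eta0 : 0 <= eta^-1 by rewrite invr_ge0 ltW.
have keta : eta^-1 < k%:R by apply: archi_boundP.
have k0R : 0 < k%:R :> R by apply: le_lt_trans keta.
have k0 : (0 < k)%N by rewrite ltr0n in k0R.
have kinv : k%:R^-1 <= eta by rewrite -[eta]invrK lef_pV2 ?posrE ?invr_gt0 // ltW.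
have kinv0 : 0 <= k%:R^-1 :> R by rewrite invr_ge0 ler0n.
have [c c0 cP] := divisors_bound k0.
(* Since 41 <= 7^2, the 7 absorbs the root of the constant of [energy_bound]; the other factor is
   the constant part of [tau]. *)
exists (7 * c%:R `^ k%:R^-1) => p T lambda gamma a K N X p_pr Tp pl g1 co_ap /andP[_ KN] KNp _.
have p_gt1 := prime_gt1 p_pr.
have N0 : (0 < N)%N by lia.
have T0 := prim_order_gt0 pl.
have a0 : (a%:~R : 'F_p) != 0.
  apply/negP; rewrite -(dvdz_pcharf (pchar_Fp p_pr)) => pa.
  by move: co_ap; rewrite coprimezE coprime_sym prime_coprime // -dvdzE pa.
pose F (x : nat) := rnorm (\sum_(i < N) gamma (K + 1 + i)%N *
  add_char R ((a%:~R : 'F_p) * lambda ^+ (x * (K + 1 + i)))).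
have FE (x : nat) : `| \sum_(K + 1 <= y < (K + N).+1)
    gamma y * e_ R p (a * (lambda : nat)%:Z ^+ (x * y)) | = (F x)%:C.
  rewrite rnormE -{1}[(K + 1)%N]add0n big_addn (_ : ((K + N).+1 - (K + 1))%N = N); last by lia.
  rewrite big_mkord; congr `|_|; apply: eq_bigr => i _; rewrite addnC; congr (_ * _).
  by rewrite -add_char_int // rmorphM rmorphXn /= -pmulrn natr_Zp.
rewrite (eq_bigr (fun x : 'I_(p.-1) => (F x)%:C)) => [|x _]; last exact: FE.
rewrite -rmorph_sum lecR.
pose tau : R := c%:R `^ k%:R^-1 * p%:R `^ k%:R^-1.
have tauP M : (M %| T)%N -> (size (divisors M))%:R <= tau.
  move=> MT; have M0 : (0 < M)%N by apply: dvdn_gt0 MT.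
  have Mp : (M <= p)%N.
    by have := dvdn_leq T0 MT; have := dvdn_leq (_ : 0 < p.-1)%N Tp; lia.
  rewrite /tau -powRM ?ler0n //.
  have -> : (size (divisors M))%:R = ((size (divisors M))%:R ^+ k) `^ k%:R^-1 :> R.
    by rewrite -powR_mulrn ?ler0n // -powRrM mulfV ?gt_eqF // powRr1 ?ler0n.
  apply: powR_le => //; first by rewrite exprn_ge0 // ler0n.
  rewrite -natrX -natrM ler_nat; apply: leq_trans (cP M M0) _.
  by rewrite leq_mul2l Mp orbT.
have Np : (0 < N <= p)%N by lia.
have EB := energy_bound p_pr (g := fun i => gamma (K + 1 + i)%N) (K + 1) a0 pl Tp (fun n => g1 _) Np tauP.
set n4 := N%:R `^ 4^-1 in EB; set P := p%:R `^ 4^-1 in EB; set t4 := T%:R `^ 4^-1 in EB.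
have p1 : 1 <= p%:R :> R by rewrite ler1n ltnW.
have tgt0 : 0 < t4 by apply: powR_gt0; rewrite ltr0n.
(* With w = p^(1/8) and fourth roots of N and T all exponents become integers, so the final
   identities are algebraic. *)
pose w : R := p%:R `^ 8^-1; pose x2 : R := #|X|%:R `^ 2^-1.
have w0 : 0 <= w by apply: powR_ge0.
have wP : w ^+ 2 = P.
  rewrite -(powR_mulrn 2 w0) /w -powRrM; congr (_ `^ _); lra.
have x20 : 0 <= x2 by apply: powR_ge0.
have n40 : 0 <= n4 by apply: powR_ge0.
have tau0 : 0 <= tau by rewrite mulr_ge0 ?powR_ge0.
have F0 x : 0 <= F x by apply: rnorm_ge0.
have main : \sum_(x in X) F x <= 7 * tau * x2 * n4 ^+ 3 * w ^+ 7 / t4.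
  have rhs0 : 0 <= 7 * tau * x2 * n4 ^+ 3 * w ^+ 7 / t4.
    by apply: divr_ge0; [repeat apply: mulr_ge0 => //; apply: exprn_ge0|apply: ltW].
  rewrite -(@ler_pXn2r _ 2) ?nnegrE ?sumr_ge0 //.
  have := cauchy_schwarz_pos (index_enum 'I_(p.-1)) (mem X) (x := fun=> 1)
    (y := fun x : 'I_(p.-1) => F x) (fun=> ler01) (fun x => F0 x).
  rewrite /=; under eq_bigr do rewrite mul1r.
  move=> H; apply: le_trans H _.
  have -> : \sum_(x in X) (1 ^+ 2 : R) = x2 ^+ 2.
    by under eq_bigr do rewrite expr1n; rewrite sumr_const /x2 powR_rootK ?ler0n.
  have EX : \sum_(x in X) F x ^+ 2 <= \sum_(x < p.-1) F x ^+ 2.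
    by rewrite big_mkcond; apply: ler_sum => x _; case: ifP => // _; rewrite exprn_ge0.
  have EX2 := le_trans EX EB.
  have m_le : (p.-1 %/ T)%:R <= P ^+ 4 / t4 ^+ 4.
    rewrite !powR_rootK ?ler0n // ler_pdivlMr ?ltr0n // -natrM ler_nat divnK //.
    exact: leq_pred.
  apply: le_trans (_ : x2 ^+ 2 * (P ^+ 4 / t4 ^+ 4 * (41 * tau ^+ 2 * (n4 ^+ 6 * P ^+ 3 * t4 ^+ 2))) <= _).
    rewrite ler_wpM2l ?exprn_ge0 //; apply: le_trans EX2 _.
    by rewrite ler_wpM2r // !mulr_ge0 ?exprn_ge0 ?powR_ge0.
  rewrite -wP.
  have -> : x2 ^+ 2 * ((w ^+ 2) ^+ 4 / t4 ^+ 4 * (41 * tau ^+ 2 * (n4 ^+ 6 * (w ^+ 2) ^+ 3 * t4 ^+ 2))) =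
     41 * (tau * x2 * n4 ^+ 3 * w ^+ 7 / t4) ^+ 2 by field; rewrite gt_eqF.
  have -> : (7 * tau * x2 * n4 ^+ 3 * w ^+ 7 / t4) ^+ 2 =
     49 * (tau * x2 * n4 ^+ 3 * w ^+ 7 / t4) ^+ 2 by field; rewrite gt_eqF.
  by rewrite ler_wpM2r ?sqr_ge0 // ler_nat.
apply: le_trans main _.
have -> : #|X|%:R `^ (1 / 2) = x2 by rewrite /x2 div1r.
have -> : T%:R `^ (1 / 4) = t4 by rewrite /t4 div1r.
have -> : N%:R `^ (3 / 4) = n4 ^+ 3 by rewrite -powR_mulrn // /n4 -powRrM mulrC.
have -> : p%:R `^ (7 / 8 + eta) = w ^+ 7 * p%:R `^ eta.
  rewrite powRD; last by apply/implyP => _; rewrite gt_eqF //; lra.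
  by rewrite -[w ^+ 7]powR_mulrn // /w -powRrM [8^-1 * _]mulrC.
have peta : p%:R `^ k%:R^-1 <= p%:R `^ eta :> R by apply: ler_powR.
rewrite /tau; set A := c%:R `^ _.
have A0 : 0 <= A by apply: powR_ge0.
have Z0 : 0 <= 7 * A * x2 * n4 ^+ 3 * w ^+ 7 / t4.
  by apply: divr_ge0; [repeat apply: mulr_ge0 => //; apply: exprn_ge0|apply: ltW].
apply: le_trans (_ : 7 * A * x2 * n4 ^+ 3 * w ^+ 7 / t4 * p%:R `^ k%:R^-1 <= _).
  by rewrite le_eqVlt; apply/orP; left; apply/eqP; ring.
apply: le_trans (ler_wpM2l Z0 peta) _.
by rewrite le_eqVlt; apply/orP; left; apply/eqP; ring.
Qed.
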